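(* Let $\Omega\subset\mathbb{R}^2$ be a bounded polygonal domain with Lipschitz boundary, let $\lambda,\mu>0$ be Lamé constants, let $\pmb{f}\in(L^2(\Omega))^2$, and let $\pmb{V}_h$, $Q_h$ be the finite element spaces constructed from a primal mesh $\mathcal{T}_h$ of $\Omega$ as in the context. Then there exists a unique solution $(\pmb{u}_h,p_h)\in\pmb{V}_h\times Q_h$ of the discrete problem $$\begin{aligned} a(\pmb{u}_h,\pmb{v}_h)+b(\pmb{v}_h,p_h)&=L_f(\pmb{v}_h), &&\forall\,\pmb{v}_h\in\pmb{V}_h,\\ b(\pmb{u}_h,q_h)-\tfrac1\lambda\,c(p_h,q_h)&=0, &&\forall\,q_h\in Q_h.\end{aligned}$$
   Context: Function spaces and forms: $\pmb{V}_0=(H_0^1(\Omega))^2$, $L_0^2(\Omega)=\{q\in L^2(\Omega):\int_\Omega q\,d\pmb{x}=0\}$. With $\varepsilon(\pmb{u})=\frac12(\nabla\pmb{u}+(\nabla\pmb{u})^T)$, $$a(\pmb{u},\pmb{v})=2\mu\int_\Omega\varepsilon(\pmb{u}):\varepsilon(\pmb{v})\,d\pmb{x},\quad b(\pmb{v},q)=\int_\Omega q\,\mathrm{div}\,\pmb{v}\,d\pmb{x},\quad c(p,q)=\int_\Omega pq\,d\pmb{x},\quad L_f(\pmb{v})=\int_\Omega\pmb{f}\cdot\pmb{v}\,d\pmb{x}$$ for $\pmb{u},\pmb{v}\in\pmb{V}_0$, $p,q\in L_0^2(\Omega)$. The Lamé constants are $\lambda=\frac{\nu E}{(1+\nu)(1-2\nu)}$,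 $\mu=\frac{E}{2(1+\nu)}$, where $E$ is the Young's modulus and $\nu$ the Poisson's ratio (the nearly incompressible case is $\nu$ close to $0.5$, i.e. $\lambda$ large). Primal mesh: $\mathcal{T}_h$ is a partition of $\overline\Omega=\bigcup_{K\in\mathcal{T}_h}K$ into non-empty connected closed subsets with pairwise disjoint interiors; each $K\in\mathcal{T}_h$ is a star-shaped polygon in which a point $C_K\in\mathrm{int}(K)$, the mesh point of $K$, is chosen. It is assumed that the segment joining the mesh points of any two neighboring elements lies inside $\Omega$ (it need not intersect their common edge). Dual mesh: let $\mathcal{N}$ be the set of all vertices of $\mathcal{T}_h$ and, for $i\in\mathcal{N}$, let $\mathcal{T}_i$ be the set of elements $K\in\mathcal{T}_h$ having $i$ as a vertex. If $i$ is an interior vertex, the dual control volume $M_i$ is the polygon obtained by connecting the mesh points of neighboring elements in $\mathcal{T}_i$. If $i\in\partial\Omega$, let $E_i\subset\partial K_i^E$ and $F_i\subset\partial K_i^F$ be the two boundary edges having $i$ as a vertex, with $K_i^E,K_i^F\in\mathcal{T}_i$ (possibly equal); $M_i$ is defined by joining the mesh points of neighboring elements in $\mathcal{T}_i$, and joining the mesh point of $K_i^E$ (resp. $K_i^F$) with the midpoint of $E_i$ (resp. $F_i$), so that $i$ is also a vertex of $M_i$. The dual mesh is $\mathcal{T}_h^{*}=\{M_i\}_{i\in\mathcal{N}}$, and $\overline\Omega=\bigcup_{i\in\mathcal{N}}M_i$. Each $M\in\mathcal{T}_h^{*}$ has a mesh point $C_M$, chosen as for the primal mesh (in the interior of $M$),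 except that if $M_i$ has edges lying on $\partial\Omega$ then $C_{M_i}$ is the vertex $i$. Third mesh: $\mathcal{T}_h^{**}$ is the triangular subgrid of the dual mesh obtained by connecting, for each $M\in\mathcal{T}_h^{*}$, the point $C_M$ to all vertices of $M$; $\overline\Omega=\bigcup_{T\in\mathcal{T}_h^{**}}\overline T$. Finite element spaces: with $\mathbb{P}^k$ the polynomials of degree at most $k$, $$\pmb{V}_h=\{\pmb{v}_h\in\pmb{V}_0:\ \pmb{v}_h|_T\in(\mathbb{P}^1(T))^2\ \ \forall T\in\mathcal{T}_h^{**}\},\qquad Q_h=\{q_h\in L_0^2(\Omega):\ q_h|_M\in\mathbb{P}^0(M)\ \ \forall M\in\mathcal{T}_h^{*}\}.$$ *)

(* Defs.v *)
From HB Require Import structures.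
From mathcomp Require Import all_boot all_order all_algebra.
From mathcomp Require Import all_classical all_reals all_analysis.
Set Implicit Arguments.
Unset Strict Implicit.
Unset Printing Implicit Defensive.
Import Order.TTheory GRing.Theory Num.Theory.
Import numFieldNormedType.Exports.
Local Open Scope classical_set_scope.
Local Open Scope ring_scope.

Section PlaneGeometry.
Variable R : realType.
Local Notation pt := (R * R)%type.
Implicit Types (a b c x y z : pt) (A Omega : set pt) (s : seq pt).

Definition frontier A : set pt := closure A `\` A°.

Definition segment a b : set pt :=
  [set (1 - t) *: a + t *: b | t in `[0, 1]%classic].

Definition midpoint a b : pt := 2^-1 *: (a + b).

Definition triangle a b c : set pt :=
  [set x | exists t1 t2 t3 : R, [/\ 0 <= t1, 0 <= t2, 0 <= t3,
     t1 + t2 + t3 = 1 & x = t1 *: a + t2 *: b + t3 *: c]].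

Definition collinear a b c : Prop :=
  (b.1 - a.1) * (c.2 - a.2) = (c.1 - a.1) * (b.2 - a.2).

(* A polygonal line is given by the cyclic list [s] of its vertices; flat angles
   are allowed, so that a vertex may lie in the middle of a straight side. *)
Definition edges s : seq (pt * pt) := zip s (rot 1 s).

Definition has_edge s a b : bool :=
  ((a, b) \in edges s) || ((b, a) \in edges s).

Definition simple_closed_line s : Prop :=
  [/\ (3 <= size s)%N, uniq s &
    forall e e' : pt * pt, e \in edges s -> e' \in edges s -> e <> e' ->
      segment e.1 e.2 `&` segment e'.1 e'.2 `<=`
      [set e.1; e.2] `&` [set e'.1; e'.2]].

(* By the Jordan curve theorem, the only compact regular closed set whose
   frontier is a simple closed line is that line together with the bounded
   component of its complement. *)
Definition is_polygon s A : Prop :=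
  [/\ simple_closed_line s, compact A, closure A° = A &
    frontier A = \bigcup_(e in [set` edges s]) segment e.1 e.2].

Definition star_shaped A : Prop :=
  exists2 z, A z & forall x, A x -> segment z x `<=` A.

Definition polygonal_domain Omega : Prop :=
  [/\ open Omega, connected Omega, Omega !=set0, bounded_set Omega &
    exists l : seq (pt * pt),
      frontier Omega = \bigcup_(e in [set` l]) segment e.1 e.2].

(* Near every frontier point, [Omega] is the strict epigraph of a Lipschitz
   function in the coordinates rotated by the angle with cosine [co] and sine
   [si]. *)
Definition lipschitz_boundary Omega : Prop :=
  forall x, frontier Omega x ->
    exists (co si : R) (g : R -> R),
      [/\ co ^+ 2 + si ^+ 2 = 1, lipschitz g &
        \forall y \near x,
          Omega y <-> g (co * y.1 + si * y.2) < co * y.2 - si * y.1].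

End PlaneGeometry.

Section Meshes.
Variable R : realType.
Local Notation pt := (R * R)%type.
Implicit Types (Omega : set pt) (i : pt).

Record primal_mesh := PrimalMesh {
  elt : finType;
  vtx : elt -> seq pt;
  cell : elt -> set pt;
  mesh_pt : elt -> pt }.

Implicit Types (Th : primal_mesh).

Definition neighbors Th (K L : elt Th) : bool :=
  (K != L) && has (fun e => has_edge (vtx L) e.1 e.2) (edges (vtx K)).

Definition mesh_vertices Th : set pt :=
  [set i | exists K : elt Th, i \in vtx K].

Definition patch_elts Th i : seq (elt Th) :=
  [seq K <- enum (elt Th) | i \in vtx K].

(* The first condition entails that the cells are non-empty, connected and
   closed. *)
Definition is_primal_mesh Omega Th : Prop :=
  [/\ forall K : elt Th, [/\ is_polygon (vtx K) (cell K),
        star_shaped (cell K) & (cell K)° (mesh_pt K)],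
      \bigcup_(K in [set: elt Th]) cell K = closure Omega,
      forall K L : elt Th, K != L -> (cell K)° `&` (cell L)° = set0 &
      forall K L : elt Th, neighbors K L ->
        segment (mesh_pt K) (mesh_pt L) `<=` Omega].

(* The control volumes are indexed by points, but only their values at the
   vertices of the primal mesh are meaningful. *)
Record dual_mesh := DualMesh {
  dual_vtx : pt -> seq pt;
  dual_cell : pt -> set pt;
  dual_pt : pt -> pt }.

Implicit Types (Td : dual_mesh).

(* [s] lists the boundary of the control volume of an interior vertex [i]: the
   mesh points of the elements around [i], met in cyclic order. *)
Definition interior_volume Th i (s : seq pt) : Prop :=
  exists Ks : seq (elt Th),
    [/\ perm_eq Ks (patch_elts Th i), cycle (@neighbors Th) Ks
      & s = map (@mesh_pt Th) Ks].

Definition boundary_edge Omega Th (K : elt Th) i e : Prop :=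
  has_edge (vtx K) i e /\ segment i e `<=` frontier Omega.

(* Here [K :: Ks] lists the elements around [i] in order, from the one carrying
   the boundary edge with endpoints [i], [e] to the one carrying the boundary
   edge with endpoints [i], [f]; it may be reduced to a single element. *)
Definition boundary_volume Omega Th i (s : seq pt) : Prop :=
  exists (e f : pt) (K : elt Th) (Ks : seq (elt Th)),
    [/\ e <> f, boundary_edge Omega K i e, boundary_edge Omega (last K Ks) i f,
        forall (L : elt Th) g, boundary_edge Omega L i g -> g = e \/ g = f &
        [/\ perm_eq (K :: Ks) (patch_elts Th i), path (@neighbors Th) K Ks &
            s = i :: midpoint i e ::
                  rcons (map (@mesh_pt Th) (K :: Ks)) (midpoint i f)]].

Definition has_boundary_side Omega (s : seq pt) : Prop :=
  exists2 e, e \in edges s & segment e.1 e.2 `<=` frontier Omega.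

Definition is_dual_mesh Omega Th Td : Prop :=
  (forall i, mesh_vertices Th i ->
    [/\ is_polygon (dual_vtx Td i) (dual_cell Td i),
        (Omega i -> interior_volume Th i (dual_vtx Td i)),
        (frontier Omega i -> boundary_volume Omega Th i (dual_vtx Td i)),
        (has_boundary_side Omega (dual_vtx Td i) -> dual_pt Td i = i) &
        (~ has_boundary_side Omega (dual_vtx Td i) ->
           (dual_cell Td i)° (dual_pt Td i))])
  /\ \bigcup_(i in mesh_vertices Th) dual_cell Td i = closure Omega.

(* When the mesh point of a control volume is one of its vertices, the two sides
   through it yield no triangle. *)
Definition third_mesh Th Td : set (set pt) :=
  [set T | exists i e, [/\ mesh_vertices Th i, e \in edges (dual_vtx Td i),
     ~ collinear (dual_pt Td i) e.1 e.2 &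
     T = triangle (dual_pt Td i) e.1 e.2]].

End Meshes.

Section Spaces.
Variable R : realType.
Local Notation pt := (R * R)%type.
Implicit Types (Omega : set pt) (v p q phi : pt -> R).

Definition leb2 :
    {measure set (measurableTypeR R * measurableTypeR R)%type -> \bar R} :=
  (@lebesgue_measure R \x @lebesgue_measure R)%E.

Definition basis2 (j : 'I_2) : pt := if j == ord0 then (1, 0) else (0, 1).

Definition partial (j : 'I_2) (v : pt -> R) : pt -> R :=
  fun x => 'D_(basis2 j) v x.

Definition smooth phi : Prop :=
  forall (s : seq 'I_2) x, differentiable (foldr partial phi s) x.

(* C_c^oo(Omega) *)
Definition test_function Omega phi : Prop :=
  [/\ smooth phi, compact (closure [set x | phi x != 0]) &
      closure [set x | phi x != 0] `<=` Omega].

(* Elements of the spaces below are represented by functions on the whole plane;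
   only their restrictions to [Omega], up to a null set, are meaningful. *)
Definition ae_eq_on Omega v w : Prop :=
  {ae leb2, forall x, Omega x -> v x = w x}.

Definition L2 Omega : set (pt -> R) :=
  [set v : pt -> R | (fun x => v x * \1_Omega x) \in Lfun leb2 2%:E].

Definition L20 Omega : set (pt -> R) :=
  [set q | L2 Omega q /\ \int[leb2]_(x in Omega) q x = 0].

Definition is_weak_partial Omega (j : 'I_2) v g : Prop :=
  L2 Omega g /\
  forall phi, test_function Omega phi ->
    \int[leb2]_(x in Omega) (v x * partial j phi x) =
    - \int[leb2]_(x in Omega) (g x * phi x).

Definition H1 Omega : set (pt -> R) :=
  [set v | L2 Omega v /\ forall j, exists g, is_weak_partial Omega j v g].

(* Weak derivatives are unique up to a null set: the choice is immaterial. *)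
Definition weak_partial Omega (j : 'I_2) v : pt -> R :=
  xget (fun=> 0) [set g | is_weak_partial Omega j v g].

(* The closure of C_c^oo(Omega) in H^1(Omega). *)
Definition H10 Omega : set (pt -> R) :=
  [set v | H1 Omega v /\
    forall eps : R, 0 < eps -> exists2 phi, test_function Omega phi &
      \int[leb2]_(x in Omega) ((v x - phi x) ^+ 2 +
        \sum_(j < 2) (weak_partial Omega j v x - partial j phi x) ^+ 2) < eps].

Definition strain Omega (u : 'I_2 -> pt -> R) (i j : 'I_2) : pt -> R :=
  fun x => 2^-1 * (weak_partial Omega j (u i) x + weak_partial Omega i (u j) x).

Definition divergence Omega (u : 'I_2 -> pt -> R) : pt -> R :=
  fun x => \sum_(j < 2) weak_partial Omega j (u j) x.

Definition form_a Omega (mu : R) (u v : 'I_2 -> pt -> R) : R :=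
  2 * mu * \int[leb2]_(x in Omega)
    (\sum_(i < 2) \sum_(j < 2) strain Omega u i j x * strain Omega v i j x).

Definition form_b Omega (v : 'I_2 -> pt -> R) q : R :=
  \int[leb2]_(x in Omega) (q x * divergence Omega v x).

Definition form_c Omega p q : R := \int[leb2]_(x in Omega) (p x * q x).

Definition load Omega (f v : 'I_2 -> pt -> R) : R :=
  \int[leb2]_(x in Omega) (\sum_(j < 2) f j x * v j x).

Definition V0 Omega : set ('I_2 -> pt -> R) :=
  [set v | forall j, H10 Omega (v j)].

Definition P1 : set (pt -> R) :=
  [set w | exists a b c : R, w = fun x => a + b * x.1 + c * x.2].

Definition P0 : set (pt -> R) := [set w | exists a : R, w = fun=> a].

Definition Vh Omega (Th : primal_mesh R) (Td : dual_mesh R) :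
    set ('I_2 -> pt -> R) :=
  [set v | V0 Omega v /\
    forall T, third_mesh Th Td T ->
      forall j, exists2 w, P1 w & ae_eq_on T (v j) w].

Definition Qh Omega (Th : primal_mesh R) (Td : dual_mesh R) : set (pt -> R) :=
  [set q | L20 Omega q /\
    forall i, mesh_vertices Th i ->
      exists2 w, P0 w & ae_eq_on (dual_cell Td i) q w].

Definition discrete_solution Omega (Th : primal_mesh R) (Td : dual_mesh R)
    (lam mu : R) (f u : 'I_2 -> pt -> R) p : Prop :=
  (forall v : 'I_2 -> pt -> R, Vh Omega Th Td v ->
     form_a Omega mu u v + form_b Omega v p = load Omega f v) /\
  (forall q, Qh Omega Th Td q ->
     form_b Omega u q - lam^-1 * form_c Omega p q = 0).

End Spaces.

(* Main.v *)
Require Import Defs.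
From HB Require Import structures.
From mathcomp Require Import all_boot all_order all_algebra.
From mathcomp Require Import all_classical all_reals all_analysis.
From mathcomp Require Import measurable_realfun.
From mathcomp Require Import ring lra.
Set Implicit Arguments.
Unset Strict Implicit.
Unset Printing Implicit Defensive.
Import Order.TTheory GRing.Theory Num.Theory.
Import numFieldNormedType.Exports.
Local Open Scope classical_set_scope.
Local Open Scope ring_scope.

(** Modulo functions that vanish almost everywhere on [Omega], [Vh] and [Qh] are
    finite-dimensional: finitely many triangles and finitely many control volumes
    cover [Omega], so a discrete pair is determined almost everywhere by finitely
    many coefficients.  The problem is thus a square linear system for the form

      B ((u, p), (v, q)) = a (u, v) + b (v, p) - b (u, q) + c (p, q) / lam,

    and B ((v, q), (v, q)) = a (v, v) + c (q, q) / lam, since the two mixed terms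
    cancel.  If this number is 0, then q = 0 and the strain of v vanishes; hence B
    is definite, a homogeneous solution is null, and a square system with no
    homogeneous solution is solvable ([galerkin_solvable], [energy_null],
    [discrete_problem_well_posed]).

    The step from zero strain to v = 0 uses Korn's inequality as a rule.  A cheaper
    argument suffices for a field in H^1_0: the diagonal entries of the strain give
    d_j v_j = 0, and a scalar function v in H^1_0 with one vanishing derivative
    d_j v is zero ([H10_partial_eq0]).  Indeed x_j phi is a test function when phi
    is one, so the definition of the weak derivative reads

      int v (phi + x_j d_j phi) = int v d_j (x_j phi) = - int (d_j v) x_j phi = 0;

    let phi tend to v in H^1, so that d_j phi tends to d_j v = 0, to get int v^2 = 0.

    It remains to know that H^1_0 is a vector space on which the chosen weak
    derivative is linear up to null sets, that is, that weak derivatives are unique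
    almost everywhere.  This is the fundamental lemma of the calculus of variations
    ([fundamental_lemma]): an integrable g on [Omega] orthogonal to the test
    functions is zero almost everywhere.  The indicator of a box is the pointwise
    limit of the smooth functions built from h (n t), where h (t) = exp (- 1 / t)
    for t > 0 and h (t) = 0 otherwise; so g integrates to zero on every box whose
    closure lies in [Omega], and a pi-lambda argument extends this to measurable
    sets. *)

(** * Smooth functions on the plane *)

Section SmoothFunctions.
Variable R : realType.
Local Notation pt := (R * R)%type.
Implicit Types (f g phi : pt -> R) (D : set (pt -> R)).

Definition coord (j : 'I_2) (x : pt) : R := if j == ord0 then x.1 else x.2.

Lemma smooth_partial j f : smooth f -> smooth (partial j f).
Proof. by move=> sf s x; rewrite -(@foldr_rcons _ _ (@partial R)). Qed.

Lemma smooth_differentiable f x : smooth f -> differentiable f x.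
Proof. by move=> sf; exact: (sf [::]). Qed.

(** The closure of [D] under sums and products, without scalars: constants are put
    in [D] when they are wanted. *)
Inductive alg_hull D : set (pt -> R) :=
  | alg_base f of D f : alg_hull D f
  | alg_add f g of alg_hull D f & alg_hull D g : alg_hull D (f \+ g)
  | alg_mul f g of alg_hull D f & alg_hull D g : alg_hull D (f \* g).

(** Coinduction for smoothness: by the Leibniz rule the closure of [D] is stable
    under partial derivatives as soon as it contains the partial derivatives of
    [D], so every iterated derivative stays among differentiable functions. *)
Lemma smooth_alg_hull D :
  (forall f x, D f -> differentiable f x) ->
  (forall f j, D f -> alg_hull D (partial j f)) ->
  alg_hull D `<=` @smooth R.
Proof.
move=> diffD partD.
have diffH f x : alg_hull D f -> differentiable f x.
  elim=> [g /diffD //|g h _ dg _ dh|g h _ dg _ dh].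
    exact: differentiableD.
  exact: differentiableM.
have partH f j : alg_hull D f -> alg_hull D (partial j f).
  elim=> [g /partD //|g h Hg dg Hh dh|g h Hg dg Hh dh].
    suff -> : partial j (g \+ h) = partial j g \+ partial j h by exact: alg_add.
    by apply/funext => x; rewrite /partial deriveD//; apply: diff_derivable; exact: diffH.
  suff -> : partial j (g \* h) = (g \* partial j h) \+ (h \* partial j g).
    by apply: alg_add; exact: alg_mul.
  by apply/funext => x; rewrite /partial deriveM//; apply: diff_derivable; exact: diffH.
move=> f Hf s x; apply: diffH.
by elim: s => //= j s; exact: partH.
Qed.

Lemma smoothM f g : smooth f -> smooth g -> smooth (f \* g).
Proof.
move=> sf sg; apply: (@smooth_alg_hull (@smooth R)); last first.
- by apply: alg_mul; exact: alg_base.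
- by move=> h j /(smooth_partial j); exact: alg_base.
- by move=> h x /smooth_differentiable.
Qed.

Lemma smoothD f g : smooth f -> smooth g -> smooth (f \+ g).
Proof.
move=> sf sg; apply: (@smooth_alg_hull (@smooth R)); last first.
- by apply: alg_add; exact: alg_base.
- by move=> h j /(smooth_partial j); exact: alg_base.
- by move=> h x /smooth_differentiable.
Qed.

Lemma partial_cst j (c : R) : partial j (cst c) = cst 0.
Proof. by apply/funext => x; rewrite /partial derive_cst. Qed.

Lemma smooth_cst (c : R) : smooth (cst c : pt -> R).
Proof.
apply: (@smooth_alg_hull [set f | exists a : R, f = cst a]); last first.
- by apply: alg_base; exists c.
- by move=> _ j [a ->]; apply: alg_base; exists 0; rewrite partial_cst.
- by move=> _ x [a ->]; exact: differentiable_cst.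
Qed.

Lemma coord_linear j : linear (coord j).
Proof. by move=> a x y; rewrite /coord; case: ifP. Qed.

HB.instance Definition _ j :=
  GRing.isLinear.Build R pt R _ (coord j) (coord_linear j).

Lemma continuous_coord j : continuous (coord j).
Proof.
move=> x; rewrite /coord; case: (j == ord0); [exact: cvg_fst|exact: cvg_snd].
Qed.

Lemma differentiable_coord j x : differentiable (coord j) x.
Proof. exact/linear_differentiable/continuous_coord. Qed.

Lemma coord_basis i j : coord i (basis2 R j) = (i == j)%:R.
Proof. by case: i j => [[|[|//]] ?] [[|[|//]] ?]. Qed.

Lemma partial_coord i j : partial i (coord j) = cst (j == i)%:R.
Proof.
apply/funext => x; rewrite /partial deriveE; last exact: differentiable_coord.
by rewrite /= -coord_basis; exact: (congr1 (@^~ (basis2 R i)) (diff_lin x (@continuous_coord j))).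
Qed.

Lemma smooth_coord j : smooth (coord j).
Proof.
apply: (@smooth_alg_hull [set f | f = coord j \/ exists a : R, f = cst a]).
- by move=> _ x [->|[a ->]]; [exact: differentiable_coord|exact: differentiable_cst].
- move=> _ i [->|[a ->]]; apply: alg_base; right.
    by rewrite partial_coord; eexists.
  by rewrite partial_cst; eexists.
- by apply: alg_base; left.
Qed.

Lemma differentiable_affine j (al be : R) x :
  differentiable (fun y => al * coord j y + be) x.
Proof.
apply: differentiableD; last exact: differentiable_cst.
by apply: differentiableZ; exact: differentiable_coord.
Qed.

Lemma differentiable_ridge (h h' : R -> R) j (al be : R) x :
  (forall t : R, is_derive t 1 h (h' t)) ->
  differentiable (fun y => h (al * coord j y + be)) x.
Proof.
move=> dh; apply: (@differentiable_comp _ _ _ _ _ h).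
  exact: differentiable_affine.
by apply/derivable1_diffP; case: (dh (al * coord j x + be)).
Qed.

(** Chain rule for a function of a single coordinate. *)
Lemma partial_ridge (h h' : R -> R) i j (al be : R) :
  (forall t : R, is_derive t 1 h (h' t)) ->
  partial i (fun y => h (al * coord j y + be)) =
  cst (al * (j == i)%:R) \* (fun y => h' (al * coord j y + be)).
Proof.
move=> dh; apply/funext => x; set t := al * coord j x + be.
have [dht h't] := dh t; have dht1 := iffLR (derivable1_diffP _ _) dht.
rewrite /partial deriveE; last exact: differentiable_ridge.
rewrite (@diff_comp _ _ _ _ (fun y => al * coord j y + be) h)//=; last first.
  exact: differentiable_affine.
rewrite deriv1E//= derive1E h't /GRing.scale/= -/t; congr (_ * _).
rewrite -deriveE; last exact: differentiable_affine.
have -> : (fun y : pt => al * coord j y + be) = al \*: coord j + cst be by [].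
rewrite deriveD; last 2 first.
- by apply: diff_derivable; apply: differentiableZ; exact: differentiable_coord.
- exact: derivable_cst.
rewrite derive_cst addr0 deriveZ; last first.
  by apply: diff_derivable; exact: differentiable_coord.
by rewrite -/(partial i (coord j) x) partial_coord.
Qed.

(** For k = 0 this is the classical smooth function that is flat at 0.  The powers
    of 1 / t make the family stable under differentiation, up to linear
    combinations. *)
Definition flat (k : nat) (t : R) : R :=
  if 0 < t then t^-1 ^+ k * expR (- t^-1) else 0.

(** The exponential series gives s^(k + 2) / (k + 2)! <= exp s for s = 1 / t > 0.
    The quadratic bound is what makes the difference quotient at 0 tend to 0. *)
Lemma flat_le k (t : R) : 0 <= flat k t <= k.+2`!%:R * t ^+ 2.
Proof.
rewrite /flat; case: ifPn => [t0|_]; last by rewrite lexx mulr_ge0// sqr_ge0.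
have s0 : 0 < t^-1 by rewrite invr_gt0.
rewrite mulr_ge0 ?expR_ge0 ?exprn_ge0 ?(ltW s0)//=.
have : t^-1 ^+ k.+2 / k.+2`!%:R <= expR t^-1.
  by apply: le_trans (expR_ge1Dxn k.+1 (ltW s0)); rewrite lerDr.
rewrite ler_pdivrMr ?ltr0n ?fact_gt0// => /(ler_wpM2r (expR_ge0 (- t^-1))).
rewrite [leRHS]mulrAC -expRD subrr expR0 mul1r => /(ler_wpM2r (sqr_ge0 t)).
apply: le_trans; rewrite le_eqVlt; apply/orP; left; apply/eqP.
rewrite -[k.+2]addn2 exprD.
by set a := t^-1 ^+ k; set e := expR _; field; rewrite gt_eqF.
Qed.

Lemma is_derive_flat_gt0 k (t : R) : 0 < t ->
  is_derive t 1 (fun s => s^-1 ^+ k * expR (- s^-1))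
    (t^-1 ^+ k.+2 * expR (- t^-1) - k%:R * (t^-1 ^+ k.+1 * expR (- t^-1))).
Proof.
move=> t0; have tn0 : t != 0 by rewrite gt_eqF.
have dV : is_derive t 1 (fun s : R => s^-1) (- t^-1 ^+ 2).
  have := @is_deriveV _ id t 1 1 tn0 (is_derive_id t 1).
  by rewrite exprVn /GRing.scale/= mulr1.
have dE : is_derive t 1 (fun s : R => expR (- s^-1)) (t^-1 ^+ 2 * expR (- t^-1)).
  have dNV : is_derive t 1 (fun s : R => - s^-1) (- - t^-1 ^+ 2) by exact: is_deriveN.
  have := @is_derive1_comp _ expR (fun s : R => - s^-1) t _ _ (is_derive_expR _) dNV.
  by rewrite opprK /GRing.scale/= mulrC.
have dX : is_derive t 1 (fun s : R => s^-1 ^+ k) (- (k%:R * t^-1 ^+ k.+1)).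
  case: k => [|k].
    rewrite mul0r oppr0; under eq_fun do rewrite expr0; exact: is_derive_cst.
  have := is_deriveX k.+1 dV; rewrite exprfctE /GRing.scale/=.
  by move=> H; apply: (is_derive_eq H); rewrite mulrN -mulrA -exprD addn2.
have := is_deriveM dX dE; rewrite mulrfctE /GRing.scale/= => H.
apply: (is_derive_eq H).
by rewrite -[k.+2]addn2 exprD; set a := _ ^+ k.+1; ring.
Qed.

Lemma is_derive_flat0 k : is_derive (0:R) 1 (flat k) 0.
Proof.
suff H : (fun h : R => h^-1 *: (flat k (h *: 1 + 0) - flat k 0)) @ 0^' --> (0 : R).
  by apply: DeriveDef; [apply/cvg_ex; exists 0|exact: cvg_lim].
have f00 : flat k 0 = 0 by rewrite /flat ltxx.
apply/cvgr0Pnorm_le => e e0; near=> h.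
rewrite f00 subr0 addr0 /GRing.scale/= mulr1 normrM normfV.
have h0 : 0 < `|h| by rewrite normr_gt0; near: h; exact: nbhs_dnbhs_neq.
rewrite ler_pdivrMl//; have /andP[f0 fle] := flat_le k h.
rewrite (ger0_norm f0) (le_trans fle)//.
rewrite -(real_normK (num_real h)) expr2 mulrA [leRHS]mulrC ler_wpM2r//.
rewrite -ler_pdivlMl ?ltr0n ?fact_gt0//.
near: h; apply: dnbhs0_le; rewrite mulr_gt0// invr_gt0 ltr0n fact_gt0//.
Unshelve. all: by end_near. Qed.

Lemma is_derive_flat k (t : R) :
  is_derive t 1 (flat k) (flat k.+2 t - k%:R * flat k.+1 t).
Proof.
have [t0|t0|->] := ltgtP t 0.
- rewrite {2 3}/flat ltNge (ltW t0)/= mulr0 subrr.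
  apply: (@near_eq_is_derive _ _ _ (cst 0)).
  near=> s; rewrite /flat ifF//; apply/negbTE; rewrite -leNgt ltW//.
  by near: s; exact: lt_nbhsl.
- rewrite {2 3}/flat t0.
  apply: near_eq_is_derive (is_derive_flat_gt0 k t0).
  by near=> s; rewrite /flat ifT//; near: s; exact: lt_nbhsr.
- rewrite {2 3}/flat ltxx mulr0 subrr; exact: is_derive_flat0.
Unshelve. all: by end_near. Qed.

Lemma smooth_flat_ridge k j (al be : R) :
  smooth (fun x => flat k (al * coord j x + be)).
Proof.
pose D := [set f | (exists a : R, f = cst a) \/
  exists n i (a b : R), f = fun x : pt => flat n (a * coord i x + b)].
apply: (@smooth_alg_hull D).
- move=> _ x [[a ->]|[n [i [a [b ->]]]]]; first exact: differentiable_cst.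
  exact: (differentiable_ridge _ _ _ _ (is_derive_flat n)).
- have Dc a : alg_hull D (cst a) by apply: alg_base; left; exists a.
  have Df n i a b : alg_hull D (fun x : pt => flat n (a * coord i x + b)).
    by apply: alg_base; right; exists n, i, a, b.
  move=> _ m [[a ->]|[n [i [a [b ->]]]]]; first by rewrite partial_cst; exact: Dc.
  rewrite (partial_ridge _ _ _ _ (is_derive_flat n)).
  apply: alg_mul; first exact: Dc.
  rewrite (_ : (fun _ => _) = (fun x : pt => flat n.+2 (a * coord i x + b)) \+
      (cst (- n%:R) \* (fun x : pt => flat n.+1 (a * coord i x + b)))).
    by apply: alg_add => //; apply: alg_mul.
  by apply/funext => x; rewrite /= mulNr.
- by apply: alg_base; right; exists k, j, al, be.
Qed.

Lemma flat0_le1 (t : R) : 0 <= flat 0 t <= 1.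
Proof.
rewrite /flat; case: ifPn => [t0|_]; last by rewrite lexx ler01.
by rewrite expr0 mul1r expR_ge0 -expR0 ler_expR oppr_le0 invr_ge0 ltW.
Qed.

(** Rescaling the argument, rather than the values, produces smooth functions with
    values in [0, 1] that tend to the indicator of t > 0. *)
Lemma flat0_cvg (t : R) : flat 0 (n%:R * t) @[n --> \oo] --> ((0 < t)%R%:R : R).
Proof.
have [t0|t0] := boolP (0 < t); last first.
  apply: cvg_near_cst; apply: nearW => n.
  by rewrite /flat ifF// pmulrn; apply/negbTE; rewrite -leNgt mulr_ge0_le0// leNgt.
have -> : 1%:R = expR 0 :> R by rewrite expR0.
rewrite -cvg_shiftS /=.
have : (fun n : nat => expR (- (n.+1%:R^-1 * t^-1))) @ \oo --> expR (0 : R).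
  apply: continuous_cvg; first exact: continuous_expR.
  rewrite -oppr0 -[X in - X](mul0r t^-1); apply: cvgN; apply: cvgMl => //.
  exact: cvg_harmonic.
apply: cvg_trans; apply: near_eq_cvg; apply: nearW => n /=.
by rewrite /flat mulr_gt0// expr0 mul1r invfM.
Qed.

End SmoothFunctions.

(** * Test functions and bumps on boxes *)

Section Bumps.
Variable R : realType.
Local Notation pt := (R * R)%type.
Implicit Types (a b x : pt) (Omega : set pt).

Definition open_box a b : set pt :=
  `]a.1, b.1[%classic `*` `]a.2, b.2[%classic.

Definition closed_box a b : set pt :=
  `[a.1, b.1]%classic `*` `[a.2, b.2]%classic.

Lemma sub_open_closed_box a b : open_box a b `<=` closed_box a b.
Proof.
by move=> x [] /= xa xb; split => /=; apply: subset_itv_oo_cc.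
Qed.

Lemma compact_closed_box a b : compact (closed_box a b).
Proof. by apply: compact_setX; exact: segment_compact. Qed.

Lemma closed_closed_box a b : closed (closed_box a b).
Proof. by apply: compact_closed; [exact: norm_hausdorff|exact: compact_closed_box]. Qed.

Definition bump a b (n : nat) (x : pt) : R :=
  flat 0 (n%:R * (x.1 - a.1)) * flat 0 (n%:R * (b.1 - x.1)) *
  (flat 0 (n%:R * (x.2 - a.2)) * flat 0 (n%:R * (b.2 - x.2))).

Lemma smooth_bump a b n : smooth (bump a b n).
Proof.
have -> : bump a b n =
    ((fun x => flat 0 (n%:R * coord 0 x + - n%:R * a.1)) \*
     (fun x => flat 0 (- n%:R * coord 0 x + n%:R * b.1))) \*
    ((fun x => flat 0 (n%:R * coord 1 x + - n%:R * a.2)) \*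
     (fun x => flat 0 (- n%:R * coord 1 x + n%:R * b.2))).
  apply/funext => x; rewrite /bump /coord /=.
  by congr (_ * _ * (_ * _)); congr (flat 0 _); ring.
by do !apply: smoothM; exact: smooth_flat_ridge.
Qed.

Lemma bump_ge0_le1 a b n x : 0 <= bump a b n x <= 1.
Proof.
have f0 t : 0 <= flat 0 (t : R) by case/andP: (flat0_le1 t).
have f1 t : flat 0 (t : R) <= 1 by case/andP: (flat0_le1 t).
by rewrite /bump !mulr_ge0//= !mulr_ile1// mulr_ge0.
Qed.

Lemma bump_neq0 a b n x : bump a b n x != 0 -> open_box a b x.
Proof.
have flat_gt0 (t : R) : flat 0 (n%:R * t) != 0 -> 0 < t.
  rewrite /flat; case: ifPn => [+ _|]; last by rewrite eqxx.
  case: n => [|n]; first by rewrite mul0r ltxx.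
  by rewrite pmulr_rgt0.
rewrite /bump !mulf_eq0 !negb_or => /andP[/andP[/flat_gt0 + /flat_gt0 +]].
rewrite !subr_gt0 => xa xb /andP[/flat_gt0 + /flat_gt0 +].
by rewrite !subr_gt0 => ya yb; split; rewrite /= in_itv/= ?xa ?ya.
Qed.

Lemma bump_cvg a b x : bump a b n x @[n --> \oo] --> (\1_(open_box a b) x : R).
Proof.
suff -> : \1_(open_box a b) x = (0 < x.1 - a.1)%R%:R * (0 < b.1 - x.1)%R%:R *
    ((0 < x.2 - a.2)%R%:R * (0 < b.2 - x.2)%R%:R) :> R.
  by apply: cvgM; apply: cvgM; exact: flat0_cvg.
rewrite indicE in_setX -!natrM !mulnb; congr (nat_of_bool _)%:R.
by rewrite !subr_gt0 !mem_setE !in_itv.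
Qed.

Lemma test_function_sub Omega phi (K : set pt) : smooth phi ->
  compact K -> closed K -> [set x | phi x != 0] `<=` K -> K `<=` Omega ->
  test_function Omega phi.
Proof.
move=> sphi cK clK phiK KO; have supp : closure [set x | phi x != 0] `<=` K.
  by rewrite (closure_id K).1//; exact: closureS.
split=> //; first by apply: subclosed_compact supp => //; exact: closed_closure.
exact: subset_trans KO.
Qed.

Lemma test_bump Omega a b n :
  closed_box a b `<=` Omega -> test_function Omega (bump a b n).
Proof.
apply: (@test_function_sub _ _ (closed_box a b)).
- exact: smooth_bump.
- exact: compact_closed_box.
- exact: closed_closed_box.
- by move=> x /= /bump_neq0; exact: sub_open_closed_box.
Qed.

Lemma test_functionM Omega phi psi : smooth psi -> test_function Omega phi ->
  test_function Omega (psi \* phi).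
Proof.
move=> spsi [sphi cphi phiO].
apply: (@test_function_sub _ _ (closure [set x | phi x != 0])) => //.
- exact: smoothM.
- exact: closed_closure.
by move=> x /=; rewrite mulf_eq0 negb_or => /andP[_ ?]; exact: subset_closure.
Qed.

Lemma test_functionD Omega phi psi :
  test_function Omega phi -> test_function Omega psi ->
  test_function Omega (phi \+ psi).
Proof.
move=> [sphi cphi phiO] [spsi cpsi psiO].
apply: (@test_function_sub _ _
  (closure [set x | phi x != 0] `|` closure [set x | psi x != 0])).
- exact: smoothD.
- exact: compactU.
- by apply: closedU; exact: closed_closure.
- move=> x /= phipsi; have [phi0|phi0] := eqVneq (phi x) 0; last first.
    by left; exact: subset_closure.
  by right; apply: subset_closure => /=; rewrite phi0 add0r in phipsi.
- by rewrite subUset.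
Qed.

Lemma test_functionZ Omega (c : R) phi :
  test_function Omega phi -> test_function Omega (cst c \* phi).
Proof. by apply: test_functionM; exact: smooth_cst. Qed.

Lemma test_function0 Omega : test_function Omega (cst 0).
Proof.
apply: (@test_function_sub _ _ set0) => //.
- exact: smooth_cst.
- exact: compact0.
- exact: closed0.
by move=> x /=; rewrite eqxx.
Qed.

Lemma test_function_partial Omega j phi : test_function Omega phi ->
  test_function Omega (partial j phi).
Proof.
move=> [sphi cphi phiO].
apply: (@test_function_sub _ _ (closure [set x | phi x != 0])) => //.
- exact: smooth_partial.
- exact: closed_closure.
(* off its support, [phi] vanishes on a neighbourhood *)
move=> x /= dphi; apply: contrapT => nx; move/eqP: dphi; apply.
rewrite /partial (@near_eq_derive _ _ _ phi (cst 0)) ?derive_cst//.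
have : (~` closure [set x | phi x != 0])° x.
  apply: open_nbhs_nbhs; split => //; apply: closed_openC.
  exact: closed_closure.
apply: filterS => y ny; apply/eqP; apply: contrapT => /negP phiy.
by apply: ny; exact: subset_closure.
Qed.

End Bumps.

(** * Borel sets of the plane *)

Section PlaneMeasure.
Variable R : realType.
Local Notation pt := (R * R)%type.
Local Notation mpt := (measurableTypeR R * measurableTypeR R)%type.
Implicit Types (a b x : pt) (Omega : set pt).

(** The boxes with rational corners whose closure lies in [Omega].  The closed
    version is what lets a bump on the box be a test function of [Omega]. *)
Lemma open_cover_boxes Omega : open Omega ->
  exists c : nat -> pt * pt,
    (forall n, closed_box (c n).1 (c n).2 `<=` Omega) /\
    Omega = \bigcup_n open_box (c n).1 (c n).2.
Proof.
move=> oO.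
pose q2 (q : (rat * rat) * (rat * rat)) : pt * pt :=
  ((ratr q.1.1, ratr q.1.2), (ratr q.2.1, ratr q.2.2)).
(* numbers that code no admissible box give an inverted, hence empty, box *)
pose c n : pt * pt := if unpickle n is Some q then
  if `[< closed_box (q2 q).1 (q2 q).2 `<=` Omega >] then q2 q
  else ((1, 1), (0, 0)) else ((1, 1), (0, 0)).
have box0 : closed_box (1, 1) (0, 0) = set0 :> set pt.
  by apply/seteqP; split => // x [/=]; rewrite in_itv/= => /andP[/le_trans H /H]; rewrite ler10.
have cO n : closed_box (c n).1 (c n).2 `<=` Omega.
  rewrite /c; case: unpickle => [q|]; last by rewrite box0.
  by case: asboolP => //= _; rewrite box0.
exists c; split => //; apply/seteqP; split => [x Ox|x [n _ /sub_open_closed_box]]; last exact: cO.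
have [e /= e0 xeO] : exists2 e : R, 0 < e & ball x e `<=` Omega.
  by have /nbhs_ballP[e e0 ?] := open_nbhs_nbhs (conj oO Ox); exists e.
have rt (t : R) : exists q : rat * rat, t - e < ratr q.1 < t /\ t < ratr q.2 < t + e.
  have [p] := @rat_in_itvoo R (t - e) t ltac:(by rewrite ltrBlDr ltrDl).
  have [p'] := @rat_in_itvoo R t (t + e) ltac:(by rewrite ltrDl).
  by rewrite !in_itv/= => H' H; exists (p, p').
have [[p1 p2] /= [/andP[a1 a2] /andP[a3 a4]]] := rt x.1.
have [[r1 r2] /= [/andP[b1 b2] /andP[b3 b4]]] := rt x.2.
exists (pickle ((p1, r1), (p2, r2))) => //.
rewrite /c pickleK /q2 /=; case: asboolP => [_|[]].
  by split; rewrite /= in_itv/= ?a2 ?a3 ?b2 ?b3.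
move=> y [/=]; rewrite !in_itv/= => /andP[u1 u2] /andP[v1 v2]; apply: xeO.
by split; rewrite /ball/= ltr_distlC ?(lt_le_trans a1 u1) ?(lt_le_trans b1 v1)
  ?(le_lt_trans u2 a4) ?(le_lt_trans v2 b4).
Qed.

Lemma measurable_open_box a b : measurable (open_box a b : set mpt).
Proof. by apply: measurableX; exact: measurable_itv. Qed.

Lemma open_measurable_plane Omega : open Omega -> measurable (Omega : set mpt).
Proof.
move=> /open_cover_boxes[c [_ ->]].
by apply: bigcupT_measurable => n; exact: measurable_open_box.
Qed.

Lemma continuous_measurable_plane (f : pt -> R) (D : set mpt) : continuous f ->
  measurable_fun D (f : mpt -> measurableTypeR R).
Proof.
move=> cf; apply: (@measurable_funTS _ _ mpt (measurableTypeR R)) => mT.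
apply: (measurability _ (RGenOInfty.measurableE R)) => //.
move=> _ [_ [x ->] <-]; rewrite setTI; apply: open_measurable_plane.
by move/continuousP: cf; apply; exact: interval_open.
Qed.

End PlaneMeasure.

(** * The fundamental lemma of the calculus of variations *)

Section PreimageDynkin.
Local Open Scope ereal_scope.
Context d d' (T : measurableType d) (T' : measurableType d') (R : realType).
Variable mu : {measure set T -> \bar R}.

(** A pi-lambda argument on the target of [X].  Taking for [X] the two projections
    and then the identity passes from boxes to all the measurable sets of a
    product. *)
Lemma integral_preimage_eq0 (G : set (set T')) (X : T -> T') (D : set T)
    (g : T -> \bar R) :
  measurable D -> measurable_fun setT X -> mu.-integrable D g ->
  @measurable _ T' = <<s G >> -> setI_closed G ->
  \int[mu]_(x in D) g x = 0 ->
  (forall A, G A -> \int[mu]_(x in D `&` X @^-1` A) g x = 0) ->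
  forall A, measurable A -> \int[mu]_(x in D `&` X @^-1` A) g x = 0.
Proof.
move=> mD mX ig GE GI g0 gG A; rewrite {1}GE.
have mDX B : measurable B -> measurable (D `&` X @^-1` B).
  by move=> mB; apply: measurableI => //; rewrite -[_ @^-1` _]setTI; exact: mX.
apply: (@dynkin_induction _ T' G (fun A => \int[mu]_(x in D `&` X @^-1` A) g x = 0)) => //.
- by rewrite preimage_setT setIT.
- move=> S mS S0.
  have : \int[mu]_(x in D `&` X @^-1` S `|` D `&` X @^-1` (~` S)) g x = 0.
    by rewrite -setIUr -preimage_setU setUv preimage_setT setIT.
  rewrite integral_setU//; last 2 first.
  - by rewrite -setIUr -preimage_setU setUv preimage_setT setIT; exact: measurable_int ig.
  - by apply/disj_setPS => x [[_ /= Sx] [_ /=]].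
  + by rewrite S0 add0e.
  + exact: mDX.
  + by apply: mDX; exact: measurableC.
- move=> F mF tF F0; rewrite preimage_bigcup setI_bigcupr.
  rewrite integral_bigcup.
  + by rewrite eseries0// => i _ _; exact: F0.
  + apply/trivIsetP => i j _ _ ij; apply/seteqP; split => // x [[_ Fi] [_ Fj]].
    by move/trivIsetP : tF => /(_ i j I I ij)/seteqP[/(_ (X x))] + _; apply.
  + by move=> k; exact: mDX.
  + apply: integrableS ig => //; last by apply: bigcup_sub => k _; exact: subIsetl.
    by apply: bigcupT_measurable => k; exact: mDX.
Qed.

End PreimageDynkin.

Section FundamentalLemma.
Variable R : realType.
Local Notation pt := (R * R)%type.
Local Notation mpt := (measurableTypeR R * measurableTypeR R)%type.
Local Notation leb2 := (leb2 R).
Implicit Types (a b x : pt) (Omega : set pt) (g : pt -> R).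

(** Dominated convergence along the bumps of the box. *)
Lemma integral_open_box_eq0 Omega g a b :
  measurable_fun (Omega : set mpt) (g : mpt -> R) -> measurable (Omega : set mpt) ->
  leb2.-integrable Omega (EFin \o g) ->
  (forall phi, test_function Omega phi -> \int[leb2]_(x in Omega) (g x * phi x) = 0) ->
  closed_box a b `<=` Omega ->
  (\int[leb2]_(x in open_box a b) (g x)%:E)%E = 0%E.
Proof.
move=> mg mO ig g0 abO.
have mb n : measurable_fun (Omega : set mpt) (bump a b n : mpt -> R).
  apply: continuous_measurable_plane => x; apply: differentiable_continuous.
  exact/smooth_differentiable/smooth_bump.
have [|||||ifg _] := @dominated_convergence _ mpt R leb2 Omega mO
  (fun n x => (g x * bump a b n x)%:E) (fun x => (g x * \1_(open_box a b) x)%:E)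
  (fun x => `|(g x)%:E|)%E.
- by move=> n; apply/measurable_EFinP; exact: measurable_funM.
- apply/measurable_EFinP; apply: measurable_funM => //.
  by apply: measurable_indic; exact: measurable_open_box.
- apply: aeW => x Ox; apply: cvg_EFin; first exact: nearW.
  apply: cvgM; [exact: cvg_cst|exact: bump_cvg].
- exact: integrable_abse.
- apply: aeW => x n Ox; rewrite /= lee_fin normrM ler_piMr//.
  by have /andP[b0 b1] := bump_ge0_le1 a b n x; rewrite ger0_norm.
have -> : (fun n => \int[leb2]_(x in Omega) (g x * bump a b n x)%:E)%E = cst 0%E.
  apply/funext => n /=; rewrite -[LHS]fineK; last first.
    apply: integrable_fin_num => //.
    apply: (le_integrable mO _ _ (integrable_abse ig)).
      by apply/measurable_EFinP; exact: measurable_funM.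
    move=> x Ox; rewrite /= normr_id lee_fin normrM ler_piMr//.
    by have /andP[b0 b1] := bump_ge0_le1 a b n x; rewrite ger0_norm.
  by have := g0 _ (test_bump n abO); rewrite /Rintegral => ->.
move=> /(cvg_unique _ (cvg_cst _)) g0box; rewrite [RHS]g0box//.
rewrite [LHS]integral_mkcond [RHS]integral_mkcond.
congr (integral _ _ _); apply/funext => x.
rewrite !patchE indicE; have [xab|_] := boolP (x \in open_box a b).
  rewrite mulr1 mem_set//; apply: abO; apply: sub_open_closed_box.
  exact: set_mem.
by rewrite mulr0; case: ifP.
Qed.

Lemma rays_setI_closed : setI_closed (@RGenOInfty.G R).
Proof.
move=> _ _ [s ->] [t ->]; exists (Num.max s t).
by apply/seteqP; split => x /=; rewrite !in_itv/= !andbT gt_max => /andP.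
Qed.

Lemma open_box_rays a b s t :
  open_box a b `&` snd @^-1` `]t, +oo[%classic `&` fst @^-1` `]s, +oo[%classic =
  open_box (Num.max a.1 s, Num.max a.2 t) b.
Proof.
rewrite /open_box; apply/seteqP; split => x /=; rewrite !in_itv/= !andbT !gt_max.
  by move=> [[[/andP[-> ->] /andP[-> ->]] ->] ->].
by move=> [/andP[/andP[-> ->] ->] /andP[/andP[-> ->] ->]].
Qed.

(** The integral of [g] is zero on the part of the box lying above any two lower
    bounds on the coordinates, as that part is again a box.  Extending this from
    rays to measurable sets, one coordinate after the other, and then from
    rectangles to measurable sets of the plane makes [g] zero almost everywhere on
    the box. *)
Lemma weakly_zero_on_box Omega g a b :
  measurable_fun (Omega : set mpt) (g : mpt -> R) -> measurable (Omega : set mpt) ->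
  leb2.-integrable Omega (EFin \o g) ->
  (forall phi, test_function Omega phi -> \int[leb2]_(x in Omega) (g x * phi x) = 0) ->
  closed_box a b `<=` Omega ->
  leb2.-negligible [set x | open_box a b x /\ g x <> 0].
Proof.
move=> mg mO ig g0 abO.
have box0 a' : a.1 <= a'.1 -> a.2 <= a'.2 ->
    (\int[leb2]_(x in open_box a' b) (g x)%:E)%E = 0%E.
  move=> a1 a2; apply: integral_open_box_eq0 g0 _ => //.
  apply: subset_trans abO => x [/=]; rewrite !in_itv/=.
  move=> /andP[/(le_trans a1) h1 h2] /andP[/(le_trans a2) h3 h4].
  by split; rewrite /= in_itv/= ?h1 ?h2 ?h3 ?h4.
have mQ := measurable_open_box a b.
have igD (D : set mpt) : measurable D -> D `<=` open_box a b ->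
    leb2.-integrable D (EFin \o g).
  move=> mD Dab; apply: integrableS ig => //.
  by apply: subset_trans abO; apply: subset_trans Dab _; exact: sub_open_closed_box.
have mf : measurable_fun [set: mpt] (fst : mpt -> measurableTypeR R) by exact: measurable_fst.
have ms : measurable_fun [set: mpt] (snd : mpt -> measurableTypeR R) by exact: measurable_snd.
have mpre (f : mpt -> measurableTypeR R) (B : set (measurableTypeR R)) :
    measurable_fun setT f -> measurable B -> measurable (f @^-1` B).
  by move=> mf' mB; rewrite -[_ @^-1` _]setTI; exact: mf'.
have mray t : measurable (`]t, +oo[%classic : set (measurableTypeR R)) by exact: measurable_itv.
have step1 t (A : set (measurableTypeR R)) : measurable A ->
  (\int[leb2]_(x in open_box a b `&` snd @^-1` `]t, +oo[%classic `&` fst @^-1` A)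
     (g x)%:E)%E = 0%E.
  apply: (integral_preimage_eq0 _ mf _ (RGenOInfty.measurableE R) rays_setI_closed).
  - by apply: measurableI => //; exact: mpre.
  - by apply: igD; [apply: measurableI => //; exact: mpre|exact: subIsetl].
  - have -> : open_box a b `&` snd @^-1` `]t, +oo[%classic =
        open_box (a.1, Num.max a.2 t) b.
      rewrite /open_box; apply/seteqP; split => x /=; rewrite !in_itv/= !andbT gt_max.
        by move=> [[-> /andP[-> ->]] ->].
      by move=> [-> /andP[/andP[-> ->] ->]].
    by rewrite box0//= le_max lexx.
  - by move=> _ [s ->]; rewrite open_box_rays box0//= le_max lexx.
have step2 (A B : set (measurableTypeR R)) : measurable A -> measurable B ->
  (\int[leb2]_(x in open_box a b `&` fst @^-1` A `&` snd @^-1` B) (g x)%:E)%E = 0%E.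
  move=> mA; move: B.
  apply: (integral_preimage_eq0 _ ms _ (RGenOInfty.measurableE R) rays_setI_closed).
  - by apply: measurableI => //; exact: mpre.
  - by apply: igD; [apply: measurableI => //; exact: mpre|exact: subIsetl].
  - have := @integral_preimage_eq0 _ _ mpt (measurableTypeR R) R leb2 _ fst
      (open_box a b) (EFin \o g) mQ mf (igD _ mQ (@subset_refl _ _))
      (RGenOInfty.measurableE R) rays_setI_closed; apply => //.
    + exact: box0.
    + move=> _ [s ->].
      have -> : open_box a b `&` fst @^-1` `]s, +oo[%classic =
          open_box (Num.max a.1 s, a.2) b.
        rewrite /open_box; apply/seteqP; split => x /=; rewrite !in_itv/= !andbT gt_max.
          by move=> [[/andP[-> ->] ->] ->].
        by move=> [/andP[/andP[-> ->] ->] ->].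
      by rewrite box0//= le_max lexx.
  - by move=> _ [t ->]; rewrite setIAC step1.
have step3 (A : set mpt) : measurable A ->
  (\int[leb2]_(x in open_box a b `&` id @^-1` A) (g x)%:E)%E = 0%E.
  apply: (integral_preimage_eq0 mQ (@measurable_id _ _ _)
    (igD _ mQ (@subset_refl _ _)) (measurable_prod_measurableType _ _)).
  - move=> _ _ [A1 mA1 [B1 mB1 <-]] [A2 mA2 [B2 mB2 <-]].
    exists (A1 `&` A2); first exact: measurableI.
    exists (B1 `&` B2); first exact: measurableI.
    by rewrite setXI.
  - exact: box0.
  - move=> _ [A1 mA1 [B1 mB1 <-]].
    have -> : open_box a b `&` id @^-1` (A1 `*` B1) =
       open_box a b `&` fst @^-1` A1 `&` snd @^-1` B1.
      by rewrite setIA.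
    exact: step2.
have := integral_ae_eq mQ (igD _ mQ (@subset_refl _ _)) (@measurable_cst _ _ mpt _ _ 0%E).
move=> /(_ _)[E Eab mE|N [mN N0 subN]].
  rewrite integral0 -[E](setIidr Eab); exact: step3.
exists N; split => // x [xab gx0]; apply: subN => /= /(_ xab) [].
exact: gx0.
Qed.

Lemma fundamental_lemma Omega g : open Omega ->
  measurable_fun (Omega : set mpt) (g : mpt -> R) ->
  leb2.-integrable Omega (EFin \o g) ->
  (forall phi, test_function Omega phi -> \int[leb2]_(x in Omega) (g x * phi x) = 0) ->
  ae_eq_on Omega g (cst 0).
Proof.
move=> oO mg ig g0; have [c [cO Oc]] := open_cover_boxes oO.
have : leb2.-negligible (\bigcup_n [set x | open_box (c n).1 (c n).2 x /\ g x <> 0]).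
  apply: negligible_bigcup => n; apply: weakly_zero_on_box mg _ ig g0 (cO n).
  exact: open_measurable_plane.
apply: negligibleS => x /= /not_implyP[Ox gx0].
by move: Ox; rewrite {1}Oc => -[n _ xn]; exists n.
Qed.

End FundamentalLemma.

(** * Square-integrable functions on a bounded open set *)

Section AlmostEverywhere.
Variable R : realType.
Local Notation pt := (R * R)%type.
Local Notation leb2 := (leb2 R).
Implicit Types P Q S : pt -> Prop.

Lemma ae_mp P Q : (forall x, P x -> Q x) ->
  {ae leb2, forall x, P x} -> {ae leb2, forall x, Q x}.
Proof. by move=> PQ; apply: negligibleS => x nQ /PQ. Qed.

Lemma ae_mp2 P Q S : (forall x, P x -> Q x -> S x) ->
  {ae leb2, forall x, P x} -> {ae leb2, forall x, Q x} -> {ae leb2, forall x, S x}.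
Proof.
move=> PQS aP aQ; apply: negligibleS (negligibleU aP aQ) => x nS.
by apply: contrapT => /not_orP[/contrapT Px /contrapT Qx]; exact/nS/PQS.
Qed.

End AlmostEverywhere.

Section SquareIntegrable.
Variable R : realType.
Local Notation pt := (R * R)%type.
Local Notation mpt := (measurableTypeR R * measurableTypeR R)%type.
Local Notation leb2 := (leb2 R).
Variable Omega : set pt.
Hypotheses (oO : open Omega) (bO : bounded_set Omega).
Implicit Types (u v w f g phi : pt -> R).

Local Notation mfun f := (measurable_fun (Omega : set mpt) (f : mpt -> R)).
Local Notation integ f := (leb2.-integrable Omega (EFin \o f)).

Let mO : measurable (Omega : set mpt).
Proof. exact: open_measurable_plane. Qed.

Lemma bounded_coord : exists2 B : R, 0 <= B & forall j x, Omega x -> `|coord j x| <= B.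
Proof.
have [M [_ HM]] := bO; exists (`|M| + 1); first by rewrite addr_ge0.
have M1 : M < `|M| + 1 by rewrite ltr_pwDr// ler_norm.
move=> j x Ox; apply: le_trans (HM _ M1 _ Ox).
by rewrite /coord prod_normE; case: ifP => _; rewrite le_max lexx ?orbT.
Qed.

Lemma finite_measure_domain : (leb2 Omega < +oo)%E.
Proof.
have [B B0 HB] := bounded_coord.
have sub : Omega `<=` `[- B, B]%classic `*` `[- B, B]%classic.
  move=> x Ox; split; rewrite /= in_itv/= -ler_norml.
    exact: (HB ord0 _ Ox).
  exact: (HB (lift ord0 ord0) _ Ox).
have mB : measurable (`[- B, B]%classic : set (measurableTypeR R)) by exact: measurable_itv.
have mBB : measurable (`[- B, B]%classic `*` `[- B, B]%classic : set mpt).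
  exact: measurableX.
apply: (@le_lt_trans _ _ (leb2 (`[- B, B]%classic `*` `[- B, B]%classic))).
  by apply: le_measure => //; rewrite inE.
rewrite [leb2 _]product_measure1E//= lebesgue_measure_itv/=.
by case: ifP => _; rewrite ?mul0e// ltry.
Qed.

Lemma L2P v : L2 Omega v <-> mfun v /\ integ (fun x => v x ^+ 2).
Proof.
split.
- move=> L2v; have := Lfun2_integrable_sqr L2v.
  have /sub_Lfun_mfun := L2v; rewrite inE/= => mv iv; split.
    apply: (eq_measurable_fun (fun x => v x * \1_Omega x)).
      by move=> x xO; rewrite indicE xO mulr1.
    exact: measurable_funTS.
  apply: (eq_integrable mO (EFin \o (fun x => (v x * \1_Omega x) ^+ 2))).
    by move=> x xO; rewrite /= indicE xO mulr1.
  exact: integrableS iv.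
- move=> [mv iv]; rewrite /L2/=.
  have vE : (fun x => v x * \1_Omega x) = v \_ Omega.
    by apply/funext => x; rewrite patchE indicE; case: ifP; rewrite ?mulr1 ?mulr0.
  rewrite vE inE; apply/andP; split; rewrite inE/=.
    exact: (iffLR (measurable_restrictT _ mO) mv).
  rewrite /finite_norm unlock/= poweR_lty//.
  have /integrableP[_] := iv; rewrite integral_mkcond; apply: le_lt_trans.
  rewrite le_eqVlt; apply/orP; left; apply/eqP; apply: eq_integral => x _.
  rewrite !patchE; case: ifP => _; last by rewrite normr0 powR0// pnatr_eq0.
  by rewrite powR_mulrn//= normrX.
Qed.

(** Domination by f^2 + g^2. *)
Lemma L2_integrableM f g : L2 Omega f -> L2 Omega g -> integ (fun x => f x * g x).
Proof.
move=> /L2P[mf f2] /L2P[mg g2].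
apply: (le_integrable mO _ _ (integrableD mO f2 g2)).
  by apply/measurable_EFinP; exact: measurable_funM.
move=> x Ox; rewrite /= lee_fin normrM [leRHS]ger0_norm ?addr_ge0 ?sqr_ge0//.
have := sqr_ge0 (`|f x| - `|g x|).
rewrite sqrrB !real_normK ?num_real// => fg.
have fg0 : 0 <= `|f x| * `|g x| by rewrite mulr_ge0.
rewrite -subr_ge0; apply: le_trans (_ : `|f x| * `|g x| +
  (f x ^+ 2 - `|f x| * `|g x| *+ 2 + g x ^+ 2) <= _).
  by rewrite addr_ge0.
by rewrite le_eqVlt; apply/orP; left; apply/eqP; ring.
Qed.

Lemma L2_bounded f (M : R) : mfun f -> (forall x, Omega x -> `|f x| <= M) -> L2 Omega f.
Proof.
move=> mf fM; apply/L2P; split => //.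
have mf2 : mfun (fun x => f x ^+ 2) by exact: measurable_funX.
apply: (measurable_bounded_integrable mO finite_measure_domain mf2).
exists (`|M| ^+ 2); split; first exact: num_real.
move=> N MN x Ox /=; rewrite (le_trans _ (ltW MN))// normrX lerXn2r ?nnegrE//.
by rewrite (le_trans (fM _ Ox))// ler_norm.
Qed.

Lemma L2_cst (c : R) : L2 Omega (cst c).
Proof. by apply: (@L2_bounded _ `|c|) => //; exact: measurable_cst. Qed.

Lemma L2_integrable f : L2 Omega f -> integ f.
Proof.
move=> L2f; apply: eq_integrable (L2_integrableM L2f (L2_cst 1)) => //.
by move=> x _; rewrite /= mulr1.
Qed.

Lemma L2_mfun f : L2 Omega f -> mfun f. Proof. by move=> /L2P[]. Qed.

Lemma integrable_scale (a : R) h : integ h -> integ (fun x => a * h x).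
Proof.
by move=> /(integrableZl mO a); apply: eq_integrable => // x _; rewrite /= EFinM.
Qed.

Lemma integrable_comb (c e : R) f g : integ f -> integ g ->
  integ (fun x => c * f x + e * g x).
Proof.
move=> fi gi.
have := integrableD mO (integrable_scale c fi) (integrable_scale e gi).
by apply: eq_integrable => // x _; rewrite /= EFinD.
Qed.

Lemma L2_comb (c e : R) f g : L2 Omega f -> L2 Omega g ->
  L2 Omega (fun x => c * f x + e * g x).
Proof.
move=> L2f L2g; have [mf f2] := iffLR (L2P f) L2f; have [mg g2] := iffLR (L2P g) L2g.
apply/L2P; split.
  by apply: measurable_funD; apply: measurable_funM => //; exact: measurable_cst.
have := integrable_comb (c ^+ 2) 1 f2
  (integrable_comb (2 * c * e) (e ^+ 2) (L2_integrableM L2f L2g) g2).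
by apply: eq_integrable => // x _; rewrite /=; congr EFin; ring.
Qed.

(** The image of the support is compact, and off the support the value is 0. *)
Lemma test_function_bounded (D : set pt) phi : test_function D phi ->
  exists M : R, forall x, `|phi x| <= M.
Proof.
move=> [sphi cphi _].
have cont : continuous phi.
  by move=> x; exact/differentiable_continuous/smooth_differentiable.
have : compact (phi @` closure [set x | phi x != 0]).
  by apply: continuous_compact => //; exact: continuous_subspaceT.
move=> /compact_bounded[M [_ HM]]; exists (`|M| + 1) => x.
have [->|phi0] := eqVneq (phi x) 0; first by rewrite normr0 addr_ge0.
apply: HM; first by rewrite ltr_pwDr// ler_norm.
by exists x => //; exact: subset_closure.
Qed.

Lemma test_function_L2 phi : test_function Omega phi -> L2 Omega phi.
Proof.
move=> tphi; have [M HM] := test_function_bounded tphi; apply: (@L2_bounded _ M) => //.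
apply: continuous_measurable_plane => x; apply: differentiable_continuous.
by apply: smooth_differentiable; case: tphi.
Qed.

Lemma Rintegral_comb (c e : R) f g : integ f -> integ g ->
  \int[leb2]_(x in Omega) (c * f x + e * g x) =
  c * \int[leb2]_(x in Omega) f x + e * \int[leb2]_(x in Omega) g x.
Proof.
by move=> fi gi; rewrite RintegralD ?RintegralZl//; exact: integrable_scale.
Qed.

Lemma ae_eq_Rintegral f g : mfun f -> mfun g -> ae_eq_on Omega f g ->
  \int[leb2]_(x in Omega) f x = \int[leb2]_(x in Omega) g x.
Proof.
move=> mf mg fg; rewrite /Rintegral; congr fine; apply: ae_eq_integral => //.
- exact/measurable_EFinP.
- exact/measurable_EFinP.
- by apply: ae_mp fg => x fgx Ox; rewrite fgx.
Qed.

Lemma integral_sqr_eq0 f : L2 Omega f ->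
  \int[leb2]_(x in Omega) (f x ^+ 2) <= 0 -> ae_eq_on Omega f (cst 0).
Proof.
move=> /L2P[mf f2] f0.
have mf2 : measurable_fun (Omega : set mpt) (fun x : mpt => (f x ^+ 2)%:E).
  by apply/measurable_EFinP; exact: measurable_funX.
have : (\int[leb2]_(x in Omega) `|(f x ^+ 2)%:E| = 0)%E.
  under eq_integral do rewrite gee0_abs ?lee_fin ?sqr_ge0//.
  rewrite -[LHS]fineK; last exact: integrable_fin_num.
  congr EFin; apply/eqP; rewrite eq_le f0/=; apply: Rintegral_ge0 => x _.
  exact: sqr_ge0.
move=> /(ae_eq_integral_abs leb2 mO mf2); apply: ae_mp => x fx Ox.
by have [/eqP] := fx Ox; rewrite sqrf_eq0 => /eqP.
Qed.

End SquareIntegrable.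

(** * Weak derivatives and the space H^1_0 *)

Section WeakDerivatives.
Variable R : realType.
Local Notation pt := (R * R)%type.
Local Notation mpt := (measurableTypeR R * measurableTypeR R)%type.
Local Notation leb2 := (leb2 R).
Variable Omega : set pt.
Hypotheses (oO : open Omega) (bO : bounded_set Omega).
Implicit Types (u v w f g h phi psi : pt -> R) (j : 'I_2).

Local Notation mfun f := (measurable_fun (Omega : set mpt) (f : mpt -> R)).
Local Notation integ f := (leb2.-integrable Omega (EFin \o f)).
Local Notation int f := (\int[leb2]_(x in Omega) f x).
Local Notation comb c v e w := (fun x => c * v x + e * w x).

Let mO : measurable (Omega : set mpt).
Proof. exact: open_measurable_plane. Qed.

Lemma partial_comb j (c e : R) phi psi : smooth phi -> smooth psi ->
  partial j (comb c phi e psi) = comb c (partial j phi) e (partial j psi).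
Proof.
move=> sphi spsi; apply/funext => x.
have dphi : derivable phi x (basis2 R j) by exact/diff_derivable/smooth_differentiable.
have dpsi : derivable psi x (basis2 R j) by exact/diff_derivable/smooth_differentiable.
rewrite /partial (_ : comb c phi e psi = c \*: phi + e \*: psi)//.
by rewrite (deriveD (derivableZ dphi) (derivableZ dpsi)) (deriveZ _ dphi) (deriveZ _ dpsi).
Qed.

Lemma test_function_comb (c e : R) phi psi : test_function Omega phi ->
  test_function Omega psi -> test_function Omega (comb c phi e psi).
Proof.
by move=> tphi tpsi; apply: test_functionD; exact: test_functionZ.
Qed.

Lemma ae_eq_Rintegral0 f : mfun f -> ae_eq_on Omega f (cst 0) ->
  \int[leb2]_(x in Omega) f x = 0.
Proof.
move=> mf f0; rewrite (ae_eq_Rintegral oO mf _ f0); last exact: measurable_cst.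
by rewrite Rintegral_cst// mul0r.
Qed.

(** The difference of two weak derivatives is orthogonal to the test functions. *)
Lemma weak_partial_unique j v g h :
  is_weak_partial Omega j v g -> is_weak_partial Omega j v h -> ae_eq_on Omega g h.
Proof.
move=> [L2g Hg] [L2h Hh].
have L2gh := L2_comb oO 1 (-1) L2g L2h.
have : ae_eq_on Omega (comb 1 g (-1) h) (cst 0).
  apply: fundamental_lemma => //; first exact: L2_mfun L2gh.
    exact: L2_integrable.
  move=> phi tphi; have L2phi := test_function_L2 oO bO tphi.
  transitivity (int (comb 1 (g \* phi) (-1) (h \* phi))).
    by apply: eq_Rintegral => x _ /=; ring.
  rewrite Rintegral_comb//; [|exact: L2_integrableM..].
  by rewrite mul1r mulN1r -[X in X - _]opprK -Hg// -Hh// addNr.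
apply: ae_mp => x ghx Ox; apply/eqP; rewrite -subr_eq0; apply/eqP.
by have := ghx Ox; rewrite mul1r mulN1r.
Qed.

Lemma is_weak_partial_comb j (c e : R) v w g h : L2 Omega v -> L2 Omega w ->
  is_weak_partial Omega j v g -> is_weak_partial Omega j w h ->
  is_weak_partial Omega j (comb c v e w) (comb c g e h).
Proof.
move=> L2v L2w [L2g Hg] [L2h Hh]; split; first exact: L2_comb.
move=> phi tphi; have L2phi := test_function_L2 oO bO tphi.
have L2dphi := test_function_L2 oO bO (test_function_partial j tphi).
transitivity (int (comb c (v \* partial j phi) e (w \* partial j phi))).
  by apply: eq_Rintegral => x _ /=; ring.
rewrite Rintegral_comb ?Hg ?Hh//; [|exact: L2_integrableM..].
transitivity (- int (comb c (g \* phi) e (h \* phi))); last first.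
  by congr (- _); apply: eq_Rintegral => x _ /=; ring.
by rewrite Rintegral_comb//; [ring|exact: L2_integrableM..].
Qed.

Lemma weak_partialP j v : H1 Omega v -> is_weak_partial Omega j v (weak_partial Omega j v).
Proof. by move=> [_ /(_ j)[g Hg]]; rewrite /weak_partial; case: xgetP => [h _ //|/(_ g)]. Qed.

Lemma H1_L2 v : H1 Omega v -> L2 Omega v. Proof. by case. Qed.

Lemma L2_weak_partial j v : H1 Omega v -> L2 Omega (weak_partial Omega j v).
Proof. by move=> /(weak_partialP j)[]. Qed.

Lemma H1_comb (c e : R) v w : H1 Omega v -> H1 Omega w -> H1 Omega (comb c v e w).
Proof.
move=> H1v H1w; split; first by apply: L2_comb => //; exact: H1_L2.
move=> j; eexists; apply: is_weak_partial_comb;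
  [exact: H1_L2|exact: H1_L2|exact: weak_partialP..].
Qed.

Lemma weak_partial_comb j (c e : R) v w : H1 Omega v -> H1 Omega w ->
  ae_eq_on Omega (weak_partial Omega j (comb c v e w))
    (comb c (weak_partial Omega j v) e (weak_partial Omega j w)).
Proof.
move=> H1v H1w; apply: (@weak_partial_unique j (comb c v e w)).
  exact/weak_partialP/H1_comb.
by apply: is_weak_partial_comb; [exact: H1_L2|exact: H1_L2|exact: weak_partialP..].
Qed.

(** Weak derivatives depend only on the almost everywhere class of the function;
    by linearity the class of 0 is enough. *)
Lemma is_weak_partial_ae0 j v : L2 Omega v -> ae_eq_on Omega v (cst 0) ->
  is_weak_partial Omega j v (cst 0).
Proof.
move=> L2v v0; split; first exact: L2_cst.
move=> phi tphi; have L2dphi := test_function_L2 oO bO (test_function_partial j tphi).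
rewrite ae_eq_Rintegral0; last 2 first.
- by apply: measurable_funM; exact: L2_mfun.
- by apply: ae_mp v0 => x v0 Ox; rewrite v0//= mul0r.
have -> : int (cst 0 \* phi) = int (cst 0).
  by apply: eq_Rintegral => x _; rewrite /= mul0r.
by rewrite Rintegral_cst// mul0r oppr0.
Qed.

Lemma weak_partial_ae0 j v : H1 Omega v -> ae_eq_on Omega v (cst 0) ->
  ae_eq_on Omega (weak_partial Omega j v) (cst 0).
Proof.
move=> H1v v0; apply: (@weak_partial_unique j v); first exact: weak_partialP.
by apply: is_weak_partial_ae0 => //; exact: H1_L2.
Qed.

(** The density of the squared H^1 distance that defines [H10]. *)
Definition H1_error v phi (x : pt) : R := (v x - phi x) ^+ 2 +
  \sum_(j < 2) (weak_partial Omega j v x - partial j phi x) ^+ 2.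

Lemma H1_error_ge0 v phi x : 0 <= H1_error v phi x.
Proof. by rewrite addr_ge0 ?sqr_ge0// sumr_ge0// => j _; exact: sqr_ge0. Qed.

Lemma sum_ord2 (F : 'I_2 -> R) : \sum_(j < 2) F j = F ord0 + F (lift ord0 ord0).
Proof. by rewrite big_ord_recl big_ord1. Qed.

Lemma H1_errorE v phi x : H1_error v phi x = (v x - phi x) ^+ 2 +
  ((weak_partial Omega ord0 v x - partial ord0 phi x) ^+ 2 +
   (weak_partial Omega (lift ord0 ord0) v x - partial (lift ord0 ord0) phi x) ^+ 2).
Proof. by rewrite /H1_error sum_ord2. Qed.

Lemma integrable_sqrB f g : L2 Omega f -> L2 Omega g -> integ (fun x => (f x - g x) ^+ 2).
Proof.
move=> L2f L2g; have /L2P [//|_] := L2_comb oO 1 (-1) L2f L2g.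
by apply: eq_integrable => // x _; rewrite /= mul1r mulN1r.
Qed.

Lemma integrable_H1_error v phi : H1 Omega v -> test_function Omega phi ->
  integ (H1_error v phi).
Proof.
move=> H1v tphi; have Hj j : integ (fun x => (weak_partial Omega j v x - partial j phi x) ^+ 2).
  apply: integrable_sqrB; first exact: L2_weak_partial.
  exact/test_function_L2/test_function_partial.
have := integrableD mO (integrable_sqrB (H1_L2 H1v) (test_function_L2 oO bO tphi))
  (integrableD mO (Hj ord0) (Hj (lift ord0 ord0))).
by apply: eq_integrable => // x _; rewrite /= H1_errorE !EFinD.
Qed.

(** From (x + y)^2 <= 2 x^2 + 2 y^2. *)
Lemma sqr_comb_le (c e a b a' b' : R) :
  (c * a + e * b - (c * a' + e * b')) ^+ 2 <=
  2 * c ^+ 2 * (a - a') ^+ 2 + 2 * e ^+ 2 * (b - b') ^+ 2.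
Proof.
rewrite -subr_ge0 (_ : _ - _ = (c * (a - a') - e * (b - b')) ^+ 2).
  exact: sqr_ge0.
by ring.
Qed.

Lemma sum3_comb (k l a b d a' b' d' : R) :
  k * (a + (b + d)) + l * (a' + (b' + d')) =
  (k * a + l * a') + ((k * b + l * b') + (k * d + l * d')).
Proof. by ring. Qed.

(** Linear combinations of approximants approximate linear combinations.  The
    comparison of the densities holds only almost everywhere, as the chosen weak
    derivative is linear only up to a null set. *)
Lemma H1_error_comb (c e : R) v w phi psi : H1 Omega v -> H1 Omega w ->
  test_function Omega phi -> test_function Omega psi ->
  int (H1_error (comb c v e w) (comb c phi e psi)) <=
  2 * c ^+ 2 * int (H1_error v phi) + 2 * e ^+ 2 * int (H1_error w psi).
Proof.
move=> H1v H1w tphi tpsi.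
have iv := integrable_H1_error H1v tphi; have iw := integrable_H1_error H1w tpsi.
have ic := integrable_H1_error (H1_comb c e H1v H1w) (test_function_comb c e tphi tpsi).
rewrite -Rintegral_comb//; rewrite /Rintegral fine_le//.
- exact: integrable_fin_num.
- exact/integrable_fin_num/integrable_comb.
apply: ae_ge0_le_integral => //.
- by move=> x _; rewrite lee_fin H1_error_ge0.
- exact: measurable_int ic.
- move=> x _; rewrite lee_fin.
  have k0 (a : R) : 0 <= 2 * a ^+ 2 by rewrite mulr_ge0// sqr_ge0.
  by apply: addr_ge0; apply: mulr_ge0 => //; exact: H1_error_ge0.
- exact: measurable_int (integrable_comb oO _ _ iv iw).
apply: ae_mp2 (weak_partial_comb ord0 c e H1v H1w)
  (weak_partial_comb (lift ord0 ord0) c e H1v H1w) => x d0 d1 Ox.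
rewrite lee_fin !H1_errorE d0// d1//.
have [sphi _ _] := tphi; have [spsi _ _] := tpsi; rewrite !partial_comb//.
by rewrite sum3_comb; do !apply: lerD; exact: sqr_comb_le.
Qed.

Lemma H10P v : H10 Omega v <-> H1 Omega v /\ forall eps : R, 0 < eps ->
  exists2 phi, test_function Omega phi & int (H1_error v phi) < eps.
Proof. by []. Qed.

Lemma comb_lt_eps (c e eps : R) : 0 < eps -> exists2 d : R, 0 < d &
  forall r s, r < d -> s < d -> 2 * c ^+ 2 * r + 2 * e ^+ 2 * s < eps.
Proof.
move=> eps0; pose k := 2 * c ^+ 2 + 2 * e ^+ 2.
have k0 : 0 <= k by rewrite addr_ge0// mulr_ge0// sqr_ge0.
have k1 : 0 < k + 1 by rewrite ltr_wpDl.
exists (eps / (k + 1)) => [|r s rd sd]; first by rewrite divr_gt0.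
apply: (@le_lt_trans _ _ (k * (eps / (k + 1)))).
  rewrite /k [leRHS]mulrDl.
  by apply: lerD; (apply: ler_wpM2l; [by rewrite mulr_ge0// sqr_ge0|exact: ltW]).
by rewrite mulrA ltr_pdivrMr// mulrC ltr_pM2l// ltrDl.
Qed.

Lemma H10_comb (c e : R) v w : H10 Omega v -> H10 Omega w -> H10 Omega (comb c v e w).
Proof.
move=> /H10P[H1v Hv] /H10P[H1w Hw]; apply/H10P; split; first exact: H1_comb.
move=> eps /(comb_lt_eps c e)[d d0 Hd].
have [phi tphi vphi] := Hv _ d0; have [psi tpsi wpsi] := Hw _ d0.
exists (comb c phi e psi); first exact: test_function_comb.
apply: le_lt_trans (H1_error_comb c e H1v H1w tphi tpsi) _.
exact: (Hd _ _ vphi wpsi).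
Qed.

Lemma H10_cst0 : H10 Omega (cst 0).
Proof.
have wp0 j : is_weak_partial Omega j (cst 0) (cst 0).
  apply: is_weak_partial_ae0; first exact: L2_cst.
  exact: aeW.
have H10 : H1 Omega (cst 0).
  by split; [exact: L2_cst|move=> j; exists (cst 0)].
apply/H10P; split=> // eps eps0; exists (cst 0); first exact: test_function0.
rewrite ae_eq_Rintegral0//.
  by apply/measurable_EFinP; apply: measurable_int (integrable_H1_error H10 (test_function0 _)).
have d0 j := weak_partial_unique (weak_partialP j H10) (wp0 j).
apply: ae_mp2 (d0 ord0) (d0 (lift ord0 ord0)) => x h0 h1 Ox.
by rewrite H1_errorE h0// h1// !partial_cst /= !subrr expr0n/= !addr0.
Qed.

Lemma partial_coordM j phi : smooth phi ->
  partial j (coord j \* phi) = phi \+ (coord j \* partial j phi).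
Proof.
move=> sphi; apply/funext => x.
have dphi : derivable phi x (basis2 R j) by exact/diff_derivable/smooth_differentiable.
have dcoord : derivable (coord j) x (basis2 R j) by exact/diff_derivable/differentiable_coord.
rewrite /partial (_ : coord j \* phi = coord j * phi)// (deriveM dcoord dphi).
have := congr1 (@^~ x) (partial_coord R j j); rewrite /partial /= eqxx => ->.
by rewrite /GRing.scale/= mulr1 addrC.
Qed.

Lemma H1_error_ge j v phi x :
  (v x - phi x) ^+ 2 + (weak_partial Omega j v x - partial j phi x) ^+ 2 <= H1_error v phi x.
Proof.
rewrite /H1_error lerD2l (bigD1 j)//= lerDl sumr_ge0// => i _.
exact: sqr_ge0.
Qed.

(** The pointwise form of [H10_partial_eq0], at a point where [w] is the value of
    d_j v and [t] the coordinate x_j.  Write v^2 = v (v - phi) - t v dphi +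
    v (phi + t dphi) and absorb half of v^2 by Young's inequality; then dphi differs
    from [w] by an error term.  The last summand is v d_j (x_j phi), whose integral
    is known exactly; [sqr_le_error] is written as nested combinations, factors 1
    included, to match [Rintegral_comb]. *)
Lemma sqr_le_error (v phi dphi w t B err : R) : t ^+ 2 <= B ->
  (v - phi) ^+ 2 + (w - dphi) ^+ 2 <= err ->
  v ^+ 2 <= 1 * (2^-1 * v ^+ 2 + (1 + 2 * B) * err) +
    1 * (2 * B * w ^+ 2 + 1 * (v * (phi + t * dphi))).
Proof.
move=> tB eB.
have B0 : 0 <= B by apply: le_trans tB; exact: sqr_ge0.
have dphi2 : t ^+ 2 * dphi ^+ 2 <= B * (2 * (w - dphi) ^+ 2 + 2 * w ^+ 2).
  apply: ler_pM => //; [exact: sqr_ge0|exact: sqr_ge0|].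
  rewrite -subr_ge0 (_ : _ - _ = (2 * w - dphi) ^+ 2); first exact: sqr_ge0.
  by ring.
have h1 := sqr_ge0 (2^-1 * v - (v - phi)).
have h2 := sqr_ge0 (2^-1 * v + t * dphi).
have h3 := sqr_ge0 (v - phi); have h4 := sqr_ge0 (w - dphi).
have h5 : (v - phi) ^+ 2 + 2 * B * (w - dphi) ^+ 2 <= (1 + 2 * B) * err.
  apply: (@le_trans _ _ ((1 + 2 * B) * ((v - phi) ^+ 2 + (w - dphi) ^+ 2))).
    rewrite -subr_ge0 (_ : _ - _ = 2 * B * (v - phi) ^+ 2 + (w - dphi) ^+ 2).
      by rewrite addr_ge0// mulr_ge0// mulr_ge0.
    by ring.
  by rewrite ler_wpM2l// addr_ge0// mulr_ge0.
rewrite -subr_ge0; set X := _ - _.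
(* the difference is the slack of the hypotheses plus two squares *)
have -> : X = ((1 + 2 * B) * err - ((v - phi) ^+ 2 + 2 * B * (w - dphi) ^+ 2)) +
  ((2^-1 * v - (v - phi)) ^+ 2 + ((2^-1 * v + t * dphi) ^+ 2 +
   (B * (2 * (w - dphi) ^+ 2 + 2 * w ^+ 2) - t ^+ 2 * dphi ^+ 2))).
  by rewrite /X; field.
apply: addr_ge0; first by rewrite subr_ge0.
by do 2 (apply: addr_ge0 => //); rewrite subr_ge0.
Qed.

(** An error below A / (2 K) contradicts A / 2 <= K * error; [small_error_absurd]
    has the shape left by integrating [sqr_le_error]. *)
Lemma small_error_absurd (A E K m : R) : 0 < A -> E < A / (2 * K) -> 0 < 2 * K ->
  A <= 1 * (2^-1 * A + K * E) + 1 * (m * 0 + 1 * 0) -> False.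
Proof.
move=> A0 EA K0; rewrite ltr_pdivlMr// in EA.
by rewrite !mulr0 addr0 mulr0 addr0 mul1r => H; lra.
Qed.

(** A replacement for the inequalities of Poincare and Korn.  Testing the weak
    derivative d_j v = 0 against x_j phi gives int v (phi + x_j d_j phi) = 0; as phi
    tends to v in H^1, the left-hand side tends to int v^2. *)
Lemma H10_partial_eq0 j v : H10 Omega v ->
  ae_eq_on Omega (weak_partial Omega j v) (cst 0) -> ae_eq_on Omega v (cst 0).
Proof.
move=> /H10P[H1v Hv] wp0; have L2v := H1_L2 H1v; have L2wp := L2_weak_partial j H1v.
have [B B0 HB] := bounded_coord bO.
apply: integral_sqr_eq0 => //; rewrite leNgt; apply/negP => A0.
have k0 : 0 < 2 * (1 + 2 * B ^+ 2).
  by rewrite mulr_gt0// ltr_pwDl// mulr_ge0// sqr_ge0.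
have [phi tphi vphi] := Hv _ (divr_gt0 A0 k0).
have [sphi _ _] := tphi.
have txphi : test_function Omega (coord j \* phi).
  by apply: test_functionM => //; exact: smooth_coord.
have L2dx := test_function_L2 oO bO (test_function_partial j txphi).
have iv2 : integ (fun x => v x ^+ 2) by case/(L2P oO) : L2v.
have iw2 : integ (fun x => weak_partial Omega j v x ^+ 2) by case/(L2P oO) : L2wp.
have ivx : integ (v \* partial j (coord j \* phi)) by exact: L2_integrableM.
have ie := integrable_H1_error H1v tphi.
have i1 := integrable_comb oO 2^-1 (1 + 2 * B ^+ 2) iv2 ie.
have i2 := integrable_comb oO (2 * B ^+ 2) 1 iw2 ivx.
have w20 : int (fun x => weak_partial Omega j v x ^+ 2) = 0.
  apply: ae_eq_Rintegral0; first by apply/measurable_EFinP; exact: measurable_int iw2.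
  by apply: ae_mp wp0 => x wx Ox; rewrite /= wx// expr0n.
have vx0 : int (v \* partial j (coord j \* phi)) = 0.
  have [_ /(_ _ txphi) ->] := weak_partialP j H1v.
  rewrite ae_eq_Rintegral0 ?oppr0//.
    by apply: measurable_funM; apply: L2_mfun => //; exact: test_function_L2.
  by apply: ae_mp wp0 => x wx Ox; rewrite /= wx// mul0r.
have : int (fun x => v x ^+ 2) <= int (comb
    1 (comb 2^-1 (fun x => v x ^+ 2) (1 + 2 * B ^+ 2) (H1_error v phi))
    1 (comb (2 * B ^+ 2) (fun x => weak_partial Omega j v x ^+ 2)
            1 (v \* partial j (coord j \* phi)))).
  apply: le_Rintegral => //; first exact: integrable_comb.
  move=> x Ox; rewrite /= partial_coordM// /=.
  apply: sqr_le_error; last exact: H1_error_ge.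
  by rewrite -(real_normK (num_real _)) lerXn2r ?nnegrE//; exact: HB.
rewrite Rintegral_comb// Rintegral_comb// Rintegral_comb// w20 vx0.
by move=> H; exact: (small_error_absurd A0 vphi k0 H).
Qed.

End WeakDerivatives.

(** * Definite linear problems of finite dimension modulo a null space *)

Section FiniteDimensional.
Variable F : fieldType.

Definition subspace (X : lmodType F) (S : set X) : Prop :=
  S 0 /\ forall a u v, S u -> S v -> S (a *: u + v).

Lemma subspace_sum (X : lmodType F) (S : set X) (n : nat)
    (c : 'I_n -> F) (b : 'I_n -> X) :
  subspace S -> (forall i, S (b i)) -> S (\sum_i c i *: b i).
Proof.
move=> [S0 SD] Sb; elim/big_rec: _ => // i x _ Sx; exact: SD.
Qed.

Lemma subspace_mulmx n m (S : set 'rV[F]_n) (A : 'M[F]_(m, n)) (x : 'rV[F]_m) :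
  subspace S -> (forall i, S (row i A)) -> S (x *m A).
Proof. by move=> subS SA; rewrite mulmx_sum_row; exact: subspace_sum. Qed.

(** Among the matrices with rows in [S], one of maximal rank has row space [S]. *)
Lemma subspace_rowspace n (S : set 'rV[F]_n) : subspace S ->
  exists M : 'M[F]_n, (forall i, S (row i M)) /\ forall u, S u -> (u <= M)%MS.
Proof.
move=> subS.
pose P r := `[< exists2 M : 'M[F]_n, forall i, S (row i M) & \rank M = r >].
have exP : exists r, P r.
  by exists 0%N; apply/asboolP; exists 0; rewrite ?mxrank0// => i; rewrite row0; case: subS.
have leP r : P r -> (r <= n)%N by move=> /asboolP[M _ <-]; exact: rank_leq_row.
case: (ex_maxnP exP leP) => r /asboolP[M SM rM] maxr.
exists M; split=> // u Su; apply: contraT => uM.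
have Scol i : S (row i (col_mx M u)).
  by case: (split_ordP i) => k ->; rewrite ?rowKu ?rowKd ?row_id// (ord1 k) row_id.
have : P (\rank (M + u)%MS).
  apply/asboolP; exists (M + u)%MS => // i.
  have /submxP[D ->] : (row i (M + u)%MS <= col_mx M u)%MS.
    by rewrite -addsmxE row_sub.
  exact: subspace_mulmx.
move=> /maxr; rewrite leqNgt -rM => /negP[]; apply: rank_ltmx.
by rewrite ltmxE addsmxSl; apply: contra uM; apply: submx_trans; exact: addsmxSr.
Qed.

(** Fredholm alternative: the columns of the cokernel of [G] are solutions of the
    homogeneous system. *)
Lemma row_solvable m n (G : 'M[F]_(m, n)) (l : 'rV[F]_n) :
  (forall x : 'cV[F]_n, G *m x = 0 -> l *m x = 0) -> exists c, c *m G = l.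
Proof.
move=> Gl; suff /submxP[c ->] : (l <= G)%MS by exists c.
rewrite submxE; apply/eqP/rowP => j.
have : l *m (cokermx G *m delta_mx j (0 : 'I_1)) = 0.
  by apply: Gl; rewrite mulmxA mulmx_coker mul0mx.
rewrite mulmxA -colE => /rowP /(_ 0); rewrite !mxE; move=> H.
by rewrite -[RHS]H.
Qed.

(** Functions represent their almost everywhere classes, and no quotient is formed:
    [S] is the trial space, [N] the null elements, and [rel s c] says that [c] is a
    family of coefficients of [s].  A given [s] may have several families of
    coefficients, but the family 0 is that of null elements only. *)
Section GalerkinSystem.
Variables (X : lmodType F) (n : nat).
Variables (S N : set X) (rel : X -> 'rV[F]_n -> Prop) (B : X -> X -> F) (L : X -> F).

Definition linear_on (f : X -> F) : Prop :=
  forall a s t, S s -> S t -> f (a *: s + t) = a * f s + f t.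

Hypothesis subS : subspace S.
Hypothesis rel_ex : forall s, S s -> exists c, rel s c.
Hypothesis rel_lin : forall a s t c e,
  rel s c -> rel t e -> rel (a *: s + t) (a *: c + e).
Hypothesis rel_null : forall s, S s -> rel s 0 -> N s.
Hypothesis B_linl : forall t, S t -> linear_on (B ^~ t).
Hypothesis B_linr : forall s, S s -> linear_on (B s).
Hypothesis L_lin : linear_on L.
Hypothesis B_nulll : forall s t, S s -> S t -> N s -> B s t = 0.
Hypothesis B_nullr : forall s t, S s -> S t -> N t -> B s t = 0.
Hypothesis L_null : forall s, S s -> N s -> L s = 0.
Hypothesis B_nondeg : forall t, S t -> (forall s, S s -> B s t = 0) -> N t.

Lemma linear_on_sum f m (c : 'I_m -> F) (b : 'I_m -> X) : linear_on f ->
  (forall i, S (b i)) -> f (\sum_i c i *: b i) = \sum_i c i * f (b i).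
Proof.
move=> linf Sb; have [S0 SD] := subS.
have f0 : f 0 = 0.
  have := linf 1 0 0 S0 S0; rewrite scaler0 addr0 mul1r => /eqP.
  by rewrite -subr_eq subrr eq_sym => /eqP.
pose K (x : X) (y : F) := S x /\ f x = y.
suff [] : K (\sum_i c i *: b i) (\sum_i c i * f (b i)) by [].
elim/big_rec2: _ => [//|i y x _ [Sx fx]].
by split; [exact: SD|rewrite linf// fx].
Qed.

Lemma linear_on_eq f s t : linear_on f -> (forall r, S r -> N r -> f r = 0) ->
  S s -> S t -> N (-1 *: s + t) -> f s = f t.
Proof.
move=> linf f0 Ss St Nst; have : f (-1 *: s + t) = 0.
  by apply: f0 => //; case: subS => _; exact.
by rewrite linf// mulN1r addrC => /eqP; rewrite subr_eq0 => /eqP.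
Qed.

(** The families of coefficients form a subspace of the row vectors; lift a
    spanning set of it to [S].  The spanning family may be dependent modulo [N]. *)
Lemma finite_spanning_family : exists b : 'I_n -> X, (forall i, S (b i)) /\
  forall s, S s -> exists c : 'I_n -> F, N (-1 *: s + \sum_i c i *: b i).
Proof.
have [S0 SD] := subS.
pose W : set 'rV[F]_n := [set c | exists2 s, S s & rel s c].
have rel00 : rel 0 0.
  have [c rc] := rel_ex S0; have := rel_lin (-1) rc rc.
  by rewrite !scaleN1r oppr0 add0r addNr.
have subW : subspace W.
  split; first by exists 0.
  by move=> a u v [s Ss su] [t St tv]; exists (a *: s + t); [exact: SD|exact: rel_lin].
have [M [WM MW]] := subspace_rowspace subW.
have WM2 i : exists s, S s /\ rel s (row i M) by have [s Ss sr] := WM i; exists s.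
have [b bP] := choice WM2.
have Sb i : S (b i) by case: (bP i).
have rel_sum m (d : 'I_m -> F) (x : 'I_m -> X) (y : 'I_m -> 'rV_n) :
    (forall i, rel (x i) (y i)) -> rel (\sum_i d i *: x i) (\sum_i d i *: y i).
  by move=> xy; elim/big_rec2: _ => // i u w _ uw; exact: rel_lin.
exists b; split => // s Ss; have [c sc] := rel_ex Ss.
have /submxP[d cE] : (c <= M)%MS by apply: MW; exists s.
exists (fun i => d 0 i); apply: rel_null; first by apply: SD => //; exact: subspace_sum.
rewrite (_ : 0 = -1 *: c + \sum_i d 0 i *: row i M); last first.
  by rewrite -mulmx_sum_row -cE scaleN1r addNr.
by apply: rel_lin => //; apply: rel_sum => i; case: (bP i).
Qed.

(** The Gram matrix [G] of the spanning family may be singular.  Yet G x = 0 makes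
    the combination t with coefficients x orthogonal to [S], hence null, so that
    L t = 0: this is the solvability condition of [row_solvable]. *)
Lemma galerkin_solvable : exists2 s, S s & forall t, S t -> B s t = L t.
Proof.
have [b [Sb bP]] := finite_spanning_family.
pose G := \matrix_(i < n, j < n) B (b i) (b j); pose l := \row_(j < n) L (b j).
have [|c cG] := @row_solvable n n G l.
  move=> x Gx; set t := \sum_j x j 0 *: b j.
  have St : S t by exact: subspace_sum.
  have Nt : N t.
    apply: B_nondeg => // s Ss; have [d Nd] := bP s Ss.
    have Sd : S (\sum_i d i *: b i) by exact: subspace_sum.
    rewrite (linear_on_eq (B_linl St) _ Ss Sd Nd); last by move=> *; exact: B_nulll.
    rewrite (linear_on_sum _ (B_linl St))//.
    apply: big1 => i _; rewrite (linear_on_sum _ (B_linr (Sb i)))//.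
    have /colP/(_ i) := Gx; rewrite !mxE => Gxi; rewrite -[X in _ * X](_ : 0 = _) ?mulr0//.
    by rewrite -{1}Gxi; apply: eq_bigr => j _; rewrite mxE mulrC.
  apply/matrixP => i k; rewrite !mxE (ord1 k) -[RHS](L_null St Nt) linear_on_sum//.
  by apply: eq_bigr => j _; rewrite mxE mulrC.
have Ss : S (\sum_i c 0 i *: b i) by exact: subspace_sum.
exists (\sum_i c 0 i *: b i) => // t St; have [d Nd] := bP t St.
have Sd : S (\sum_i d i *: b i) by exact: subspace_sum.
rewrite (linear_on_eq (B_linr Ss) _ St Sd Nd); last by move=> *; exact: B_nullr.
rewrite (linear_on_eq L_lin _ St Sd Nd); last by move=> *; exact: L_null.
rewrite (linear_on_sum _ (B_linr Ss))//.
rewrite linear_on_sum//; apply: eq_bigr => j _; congr (_ * _).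
rewrite (linear_on_sum _ (B_linl (Sb j)))//.
by have /rowP/(_ j) := cG; rewrite !mxE => <-; apply: eq_bigr => i _; rewrite mxE.
Qed.

End GalerkinSystem.

End FiniteDimensional.

(** * The bilinear forms of linear elasticity *)

Section Forms.
Variable R : realType.
Local Notation pt := (R * R)%type.
Local Notation mpt := (measurableTypeR R * measurableTypeR R)%type.
Local Notation leb2 := (leb2 R).
Variable Omega : set pt.
Hypotheses (oO : open Omega) (bO : bounded_set Omega).
Implicit Types (f g h p q r : pt -> R) (u v w : 'I_2 -> pt -> R) (i j k : 'I_2).

Local Notation ip f g := (\int[leb2]_(x in Omega) (f x * g x)).
Local Notation comb c v e w := (fun x => c * v x + e * w x).
Local Notation vcomb c v e w := (fun i x => c * v i x + e * w i x).
Local Notation null f := (ae_eq_on Omega f (cst 0)).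

Let mO : measurable (Omega : set mpt).
Proof. exact: open_measurable_plane. Qed.

Lemma ipC f g : ip f g = ip g f.
Proof. by apply: eq_Rintegral => x _; rewrite mulrC. Qed.

(** Linearity is stated for [r] equal to the combination almost everywhere, since
    strains and divergences are linear only in that sense. *)
Lemma ip_comb (c e : R) f g h r : L2 Omega f -> L2 Omega g -> L2 Omega h -> L2 Omega r ->
  ae_eq_on Omega r (comb c f e g) -> ip r h = c * ip f h + e * ip g h.
Proof.
move=> L2f L2g L2h L2r rE.
have ifh := L2_integrableM oO L2f L2h; have igh := L2_integrableM oO L2g L2h.
rewrite -(Rintegral_comb oO c e ifh igh); apply: (ae_eq_Rintegral oO).
- by apply/measurable_EFinP; exact: measurable_int (L2_integrableM oO L2r L2h).
- by apply/measurable_EFinP; exact: measurable_int (integrable_comb oO c e ifh igh).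
- by apply: ae_mp rE => x rx Ox; rewrite rx//=; ring.
Qed.

Lemma ip_null f g : L2 Omega f -> L2 Omega g -> null f -> ip f g = 0.
Proof.
move=> L2f L2g f0; rewrite (@ip_comb 0 0 f f g f)// ?mul0r ?addr0//.
by apply: ae_mp f0 => x fx Ox; rewrite !mul0r addr0 fx.
Qed.

Lemma ip_sqr_ge0 f : 0 <= ip f f.
Proof. by apply: Rintegral_ge0 => x _; rewrite -expr2 sqr_ge0. Qed.

Lemma ip_sqr_eq0 f : L2 Omega f -> ip f f = 0 -> null f.
Proof.
move=> L2f f0; apply: integral_sqr_eq0 => //.
rewrite le_eqVlt; apply/orP; left; apply/eqP; rewrite -[RHS]f0.
by apply: eq_Rintegral => x _; rewrite expr2.
Qed.

Lemma Rintegral_sum_ord2 (F : 'I_2 -> pt -> R) :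
  (forall i, leb2.-integrable Omega (EFin \o F i)) ->
  leb2.-integrable Omega (EFin \o (fun x => \sum_(i < 2) F i x)) /\
  \int[leb2]_(x in Omega) (\sum_(i < 2) F i x) = \sum_(i < 2) \int[leb2]_(x in Omega) F i x.
Proof.
move=> iF; split.
  have := integrable_comb oO 1 1 (iF ord0) (iF (lift ord0 ord0)).
  by apply: eq_integrable => // x _; rewrite /= sum_ord2 !mul1r.
rewrite sum_ord2 -[RHS]/(_ + _) -RintegralD//.
by apply: eq_Rintegral => x _; rewrite sum_ord2.
Qed.

Lemma V0_H1 v i : V0 Omega v -> H1 Omega (v i).
Proof. by move=> /(_ i)[]. Qed.

Lemma V0_comb (c e : R) u v : V0 Omega u -> V0 Omega v -> V0 Omega (vcomb c u e v).
Proof. by move=> Vu Vv i; exact: H10_comb. Qed.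

Lemma L2_strain u i j : V0 Omega u -> L2 Omega (strain Omega u i j).
Proof.
move=> Vu; have := L2_comb oO 2^-1 2^-1
  (L2_weak_partial j (V0_H1 i Vu)) (L2_weak_partial i (V0_H1 j Vu)).
by rewrite /strain; under [in X in _ -> X]eq_fun do rewrite mulrDr.
Qed.

Lemma strain_comb (c e : R) u v i j : V0 Omega u -> V0 Omega v ->
  ae_eq_on Omega (strain Omega (vcomb c u e v) i j)
    (comb c (strain Omega u i j) e (strain Omega v i j)).
Proof.
move=> Vu Vv.
have dij := weak_partial_comb oO bO j c e (V0_H1 i Vu) (V0_H1 i Vv).
have dji := weak_partial_comb oO bO i c e (V0_H1 j Vu) (V0_H1 j Vv).
apply: ae_mp2 dij dji => x Hij Hji Ox; rewrite /strain Hij// Hji//.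
set a := weak_partial _ _ _ _; set b := weak_partial _ _ _ _.
set a' := weak_partial _ _ _ _; set b' := weak_partial _ _ _ _.
by ring.
Qed.

Lemma strain_null u i j : V0 Omega u -> (forall k, null (u k)) -> null (strain Omega u i j).
Proof.
move=> Vu u0.
have dij := weak_partial_ae0 oO bO j (V0_H1 i Vu) (u0 i).
have dji := weak_partial_ae0 oO bO i (V0_H1 j Vu) (u0 j).
by apply: ae_mp2 dij dji => x Hij Hji Ox; rewrite /strain Hij// Hji//= addr0 mulr0.
Qed.

Lemma divergenceE u : divergence Omega u = weak_partial Omega ord0 (u ord0) \+
  weak_partial Omega (lift ord0 ord0) (u (lift ord0 ord0)).
Proof. by apply/funext => x; rewrite /divergence sum_ord2. Qed.

Lemma L2_add f g : L2 Omega f -> L2 Omega g -> L2 Omega (f \+ g).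
Proof.
move=> L2f L2g; have := L2_comb oO 1 1 L2f L2g.
by under eq_fun do rewrite !mul1r.
Qed.

Lemma L2_divergence u : V0 Omega u -> L2 Omega (divergence Omega u).
Proof.
by move=> Vu; rewrite divergenceE; apply: L2_add; apply: L2_weak_partial; exact: V0_H1.
Qed.

Lemma divergence_comb (c e : R) u v : V0 Omega u -> V0 Omega v ->
  ae_eq_on Omega (divergence Omega (vcomb c u e v))
    (comb c (divergence Omega u) e (divergence Omega v)).
Proof.
move=> Vu Vv; have d k := weak_partial_comb oO bO k c e (V0_H1 k Vu) (V0_H1 k Vv).
apply: ae_mp2 (d ord0) (d (lift ord0 ord0)) => x H0 H1' Ox.
rewrite !divergenceE /= H0// H1'//.
set a := weak_partial _ _ _ _; set b := weak_partial _ _ _ _.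
set a' := weak_partial _ _ _ _; set b' := weak_partial _ _ _ _.
by ring.
Qed.

Lemma divergence_null u : V0 Omega u -> (forall k, null (u k)) -> null (divergence Omega u).
Proof.
move=> Vu u0; have d k := weak_partial_ae0 oO bO k (V0_H1 k Vu) (u0 k).
apply: ae_mp2 (d ord0) (d (lift ord0 ord0)) => x H0 H1' Ox.
by rewrite divergenceE /= H0// H1'//= addr0.
Qed.

Definition strain_ip u v : R :=
  \sum_(i < 2) \sum_(j < 2) ip (strain Omega u i j) (strain Omega v i j).

Lemma form_aE (mu : R) u v : V0 Omega u -> V0 Omega v ->
  form_a Omega mu u v = 2 * mu * strain_ip u v.
Proof.
move=> Vu Vv; rewrite /form_a; congr (_ * _).
have Hij i j : leb2.-integrable Omega (EFin \o (strain Omega u i j \* strain Omega v i j)).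
  by apply: L2_integrableM => //; exact: L2_strain.
have Hi i := Rintegral_sum_ord2 (Hij i).
have [_ ->] := Rintegral_sum_ord2 (fun i => (Hi i).1).
by apply: eq_bigr => i _; rewrite (Hi i).2.
Qed.

Lemma form_aC (mu : R) u v : V0 Omega u -> V0 Omega v ->
  form_a Omega mu u v = form_a Omega mu v u.
Proof.
move=> Vu Vv; rewrite (form_aE mu Vu Vv) (form_aE mu Vv Vu).
have -> // : strain_ip u v = strain_ip v u.
by apply: eq_bigr => i _; apply: eq_bigr => j _; exact: ipC.
Qed.

Lemma strain_ip_combl (c e : R) u v w : V0 Omega u -> V0 Omega v -> V0 Omega w ->
  strain_ip (vcomb c u e v) w = c * strain_ip u w + e * strain_ip v w.
Proof.
move=> Vu Vv Vw; rewrite /strain_ip.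
rewrite !mulr_sumr -big_split; apply: eq_bigr => i _ /=.
rewrite !mulr_sumr -big_split; apply: eq_bigr => j _ /=.
apply: ip_comb; [exact: L2_strain|exact: L2_strain|exact: L2_strain| |exact: strain_comb].
exact/L2_strain/V0_comb.
Qed.

Lemma form_a_combl (mu c e : R) u v w : V0 Omega u -> V0 Omega v -> V0 Omega w ->
  form_a Omega mu (vcomb c u e v) w = c * form_a Omega mu u w + e * form_a Omega mu v w.
Proof.
move=> Vu Vv Vw; rewrite (form_aE mu (V0_comb c e Vu Vv) Vw).
rewrite (form_aE mu Vu Vw) (form_aE mu Vv Vw) (strain_ip_combl c e Vu Vv Vw).
by move: (strain_ip u w) (strain_ip v w) => a b; ring.
Qed.

Lemma form_a_null (mu : R) u v : V0 Omega u -> V0 Omega v -> (forall k, null (u k)) ->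
  form_a Omega mu u v = 0.
Proof.
move=> Vu Vv u0; rewrite (form_aE mu Vu Vv) /strain_ip big1 ?mulr0// => i _.
rewrite big1// => j _.
by apply: ip_null; [exact: L2_strain|exact: L2_strain|exact: strain_null].
Qed.

Lemma form_bE v q : form_b Omega v q = ip (divergence Omega v) q.
Proof. exact: ipC. Qed.

Lemma form_b_comb_v (c e : R) u v q : V0 Omega u -> V0 Omega v -> L2 Omega q ->
  form_b Omega (vcomb c u e v) q = c * form_b Omega u q + e * form_b Omega v q.
Proof.
move=> Vu Vv L2q; rewrite !form_bE.
apply: ip_comb => //; [exact: L2_divergence|exact: L2_divergence| |exact: divergence_comb].
exact/L2_divergence/V0_comb.
Qed.

Lemma form_b_comb_q (c e : R) v p q : V0 Omega v -> L2 Omega p -> L2 Omega q ->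
  form_b Omega v (comb c p e q) = c * form_b Omega v p + e * form_b Omega v q.
Proof.
move=> Vv L2p L2q; apply: ip_comb => //; [exact: L2_divergence|exact: L2_comb|exact: aeW].
Qed.

Lemma form_b_null_v v q : V0 Omega v -> L2 Omega q -> (forall k, null (v k)) ->
  form_b Omega v q = 0.
Proof.
move=> Vv L2q v0; rewrite form_bE.
by apply: ip_null => //; [exact: L2_divergence|exact: divergence_null].
Qed.

Lemma form_b_null_q v q : V0 Omega v -> L2 Omega q -> null q -> form_b Omega v q = 0.
Proof. by move=> Vv L2q q0; apply: ip_null => //; exact: L2_divergence. Qed.

Lemma form_cC p q : form_c Omega p q = form_c Omega q p.
Proof. exact: ipC. Qed.

Lemma form_c_null p q : L2 Omega p -> L2 Omega q -> null p -> form_c Omega p q = 0.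
Proof. exact: ip_null. Qed.

Lemma form_c_comb (c e : R) p q r : L2 Omega p -> L2 Omega q -> L2 Omega r ->
  form_c Omega (comb c p e q) r = c * form_c Omega p r + e * form_c Omega q r.
Proof. by move=> L2p L2q L2r; apply: ip_comb => //; [exact: L2_comb|exact: aeW]. Qed.

Lemma loadE (f : 'I_2 -> pt -> R) v : (forall j, L2 Omega (f j)) -> V0 Omega v ->
  load Omega f v = \sum_(j < 2) ip (v j) (f j).
Proof.
move=> L2f Vv; rewrite /load.
have [_ ->] := Rintegral_sum_ord2 (fun j => L2_integrableM oO (L2f j) (H1_L2 (V0_H1 j Vv))).
by apply: eq_bigr => j _; exact: ipC.
Qed.

Lemma load_comb (f : 'I_2 -> pt -> R) (c e : R) u v : (forall j, L2 Omega (f j)) ->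
  V0 Omega u -> V0 Omega v ->
  load Omega f (vcomb c u e v) = c * load Omega f u + e * load Omega f v.
Proof.
move=> L2f Vu Vv; rewrite (loadE L2f (V0_comb c e Vu Vv)) (loadE L2f Vu) (loadE L2f Vv).
rewrite !mulr_sumr -big_split; apply: eq_bigr => j _ /=.
have L2u := H1_L2 (V0_H1 j Vu); have L2v := H1_L2 (V0_H1 j Vv).
by apply: ip_comb => //; [exact: L2_comb|exact: aeW].
Qed.

Lemma load_null (f : 'I_2 -> pt -> R) v : (forall j, L2 Omega (f j)) ->
  V0 Omega v -> (forall k, null (v k)) -> load Omega f v = 0.
Proof.
move=> L2f Vv v0; rewrite loadE// big1// => j _.
by apply: ip_null => //; exact: H1_L2 (V0_H1 j Vv).
Qed.

Lemma strain_ip_ge0 u : 0 <= strain_ip u u.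
Proof. by rewrite sumr_ge0// => i _; rewrite sumr_ge0// => j _; exact: ip_sqr_ge0. Qed.

Lemma strain_ip_eq0 u k : strain_ip u u = 0 -> ip (strain Omega u k k) (strain Omega u k k) = 0.
Proof.
have s_ge0 i : 0 <= \sum_(j < 2) ip (strain Omega u i j) (strain Omega u i j).
  by rewrite sumr_ge0// => j _; exact: ip_sqr_ge0.
move=> /(psumr_eq0P (fun i _ => s_ge0 i))/(_ k isT).
by move=> /(psumr_eq0P (fun j _ => ip_sqr_ge0 _))/(_ k isT).
Qed.

Lemma energy_eq0 (lam mu s c : R) : 0 < lam -> 0 < mu -> 0 <= s -> 0 <= c ->
  2 * mu * s + lam^-1 * c = 0 -> s = 0 /\ c = 0.
Proof.
move=> lam0 mu0 s0 c0; have li0 : 0 <= lam^-1 by rewrite invr_ge0 ltW.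
have m0 : 0 <= 2 * mu by rewrite mulr_ge0// ltW.
move=> /eqP; rewrite (paddr_eq0 (mulr_ge0 m0 s0) (mulr_ge0 li0 c0)) !mulf_eq0 invr_eq0.
by rewrite (gt_eqF mu0) (gt_eqF lam0) pnatr_eq0/= => /andP[/eqP -> /eqP ->].
Qed.

(** Only the diagonal of the strain is used: it forces d_k v_k = 0 for each k, which
    is enough by [H10_partial_eq0]. *)
Lemma energy_null (lam mu : R) v q : 0 < lam -> 0 < mu -> V0 Omega v -> L2 Omega q ->
  form_a Omega mu v v + lam^-1 * form_c Omega q q = 0 ->
  (forall k, null (v k)) /\ null q.
Proof.
move=> lam0 mu0 Vv L2q; rewrite (form_aE mu Vv Vv).
move=> /(energy_eq0 lam0 mu0 (strain_ip_ge0 v) (ip_sqr_ge0 q))[sv0 cq0].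
split; last exact: ip_sqr_eq0.
move=> k; apply: (H10_partial_eq0 oO bO (j := k)) => //.
have := ip_sqr_eq0 (L2_strain k k Vv) (strain_ip_eq0 k sv0); apply: ae_mp => x sx Ox.
have := sx Ox; rewrite /strain /= => /eqP; rewrite mulf_eq0 invr_eq0 pnatr_eq0/=.
by rewrite -mulr2n mulrn_eq0/= => /eqP.
Qed.

End Forms.

(** * The discrete problem *)

Section DiscreteSpaces.
Variable R : realType.
Local Notation pt := (R * R)%type.
Local Notation leb2 := (leb2 R).
Implicit Types (f g : pt -> R) (T D : set pt).

Local Notation comb c v e w := (fun x => c * v x + e * w x).

Lemma ae_eq_on_comb T (c e : R) f g f' g' : ae_eq_on T f f' -> ae_eq_on T g g' ->
  ae_eq_on T (comb c f e g) (comb c f' e g').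
Proof. by apply: ae_mp2 => x ff' gg' Tx; rewrite ff'// gg'. Qed.

Lemma ae_eq_of_difference T f g :
  ae_eq_on T (comb (-1) f 1 g) (cst 0) -> ae_eq_on T g f.
Proof.
apply: ae_mp => x fg Tx; have := fg Tx; rewrite mulN1r mul1r addrC => /eqP.
by rewrite subr_eq0 => /eqP.
Qed.

Lemma ae_eq_on_cover (I : finType) (F : I -> set pt) D f g :
  D `<=` \bigcup_i F i -> (forall i, ae_eq_on (F i) f g) -> ae_eq_on D f g.
Proof.
move=> DF fg; pose G n : set pt := if unpickle n is Some i then
  [set x | ~ (F i x -> f x = g x)] else set0.
have : leb2.-negligible (\bigcup_n G n).
  apply: negligible_bigcup => n; rewrite /G; case: unpickle => [i|].
    exact: fg.
  exact: negligible_set0.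
apply: negligibleS => x /= /not_implyP[Dx fgx]; have [i _ Fx] := DF x Dx.
by exists (pickle i) => //; rewrite /G pickleK => /(_ Fx).
Qed.

Lemma finite_mesh_vertices (Th : primal_mesh R) : exists (J : finType) (y : J -> pt),
  (forall k, mesh_vertices Th (y k)) /\ forall i, mesh_vertices Th i -> exists k, i = y k.
Proof.
pose s := flatten [seq vtx K | K <- enum (elt Th)].
exists (seq_sub s), val; split=> [k|i [K iK]].
  by have /flatten_mapP[K _ kK] := valP k; exists K.
have si : i \in s by apply/flatten_mapP; exists K => //; rewrite mem_enum.
by exists (SeqSub si).
Qed.

Lemma finite_third_mesh (Th : primal_mesh R) (Td : dual_mesh R) :
  exists (I : finType) (T : I -> set pt), (forall k, third_mesh Th Td (T k)) /\
    forall T', third_mesh Th Td T' -> exists k, T' = T k.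
Proof.
have [J [y [Vy yV]]] := finite_mesh_vertices Th.
pose tri (i : pt) (e : pt * pt) := triangle (dual_pt Td i) e.1 e.2.
pose good (ie : pt * (pt * pt)) := `[< third_mesh Th Td (tri ie.1 ie.2) >].
pose s := [seq ie <- flatten [seq [seq (y k, e) | e <- edges (dual_vtx Td (y k))]
                             | k <- enum J] | good ie].
exists (seq_sub s), (fun ie => tri (val ie).1 (val ie).2); split=> [k|T' HT'].
  by have := valP k; rewrite mem_filter => /andP[/asboolP].
have [i [e [Vi ei nc T'E]]] := HT'; have [k iE] := yV i Vi.
have sie : (i, e) \in s.
  rewrite mem_filter; apply/andP; split; first by apply/asboolP; rewrite /tri /= -T'E.
  apply/flatten_mapP; exists k; first by rewrite mem_enum.
  by rewrite -iE; apply/mapP; exists e.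
by exists (SeqSub sie).
Qed.

End DiscreteSpaces.

Section DiscreteProblem.
Variable R : realType.
Local Notation pt := (R * R)%type.
Local Notation leb2 := (leb2 R).
Variable Omega : set pt.
Hypotheses (oO : open Omega) (bO : bounded_set Omega).
Variables (Th : primal_mesh R) (Td : dual_mesh R).
Local Notation comb c v e w := (fun x => c * v x + e * w x).
Local Notation vcomb c v e w := (fun (i : 'I_2) x => c * v i x + e * w i x).
Local Notation null f := (ae_eq_on Omega f (cst 0)).
Local Notation Vh := (Vh Omega Th Td).
Local Notation Qh := (Qh Omega Th Td).

Lemma Vh_comb (c e : R) u v : Vh u -> Vh v -> Vh (vcomb c u e v).
Proof.
move=> [Vu Pu] [Vv Pv]; split; first exact: V0_comb.
move=> T TT j; have [_ [a [b [d ->]]] uT] := Pu T TT j.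
have [_ [a' [b' [d' ->]]] vT] := Pv T TT j.
eexists; last exact: ae_eq_on_comb uT vT.
exists (c * a + e * a'), (c * b + e * b'), (c * d + e * d').
by apply/funext => x; ring.
Qed.

Lemma Vh0 : Vh (fun=> cst 0).
Proof.
split; first by move=> j; exact: H10_cst0.
move=> T _ j; exists (cst 0); last exact: aeW.
by exists 0, 0, 0; apply/funext => x; rewrite /= !mul0r !addr0.
Qed.

Lemma Qh_comb (c e : R) p q : Qh p -> Qh q -> Qh (comb c p e q).
Proof.
move=> [[L2p p0] Pp] [[L2q q0] Pq]; split.
  split; first exact: L2_comb.
  rewrite Rintegral_comb ?p0 ?q0 ?mulr0 ?addr0//; exact: L2_integrable.
move=> i Vi; have [_ [a ->] pa] := Pp i Vi; have [_ [b ->] qb] := Pq i Vi.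
by eexists; last exact: ae_eq_on_comb pa qb; exists (c * a + e * b).
Qed.

Lemma Qh0 : Qh (cst 0).
Proof.
split; first split; [exact: L2_cst| |].
  by rewrite Rintegral_cst ?mul0r//; exact: open_measurable_plane.
by move=> i _; exists (cst 0); [exists 0|exact: aeW].
Qed.

Definition discrete_space : set (('I_2 -> pt -> R) * (pt -> R)) :=
  [set s | Vh s.1 /\ Qh s.2].

Definition null_pair (s : ('I_2 -> pt -> R) * (pt -> R)) : Prop :=
  (forall j, null (s.1 j)) /\ null s.2.

Local Notation X := (('I_2 -> pt -> R) * (pt -> R))%type.

Lemma comb1E (a : R) (s t : X) : (a *: s + t).1 = vcomb a s.1 1 t.1.
Proof. by apply/funext => i; apply/funext => x; rewrite mul1r. Qed.

Lemma comb2E (a : R) (s t : X) : (a *: s + t).2 = comb a s.2 1 t.2.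
Proof. by apply/funext => x; rewrite mul1r. Qed.

Lemma subspace_discrete : subspace (discrete_space : set X).
Proof.
split; first by split; [exact: Vh0|exact: Qh0].
move=> a u v [Vu Qu] [Vv Qv]; split; first by rewrite comb1E; exact: Vh_comb.
by rewrite comb2E; exact: Qh_comb.
Qed.


(** The coefficients of a discrete pair are the three coefficients of each component
    of the displacement on each triangle and the value of the pressure on each control
    volume.  Null coefficients make the pair null because the triangles, as well as
    the control volumes, cover [Omega]. *)
Lemma discrete_coordinates :
  \bigcup_(T in third_mesh Th Td) T = closure Omega ->
  \bigcup_(i in mesh_vertices Th) dual_cell Td i = closure Omega ->
  exists (n : nat) (rel : X -> 'rV[R]_n -> Prop),
  [/\ forall s, discrete_space s -> exists c, rel s c,
      forall a s t c e, rel s c -> rel t e -> rel (a *: s + t) (a *: c + e) &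
      forall s, discrete_space s -> rel s 0 -> null_pair s].
Proof.
move=> covT covM.
have [I [T [IT TI]]] := finite_third_mesh Th Td.
have [J [y [Jy yJ]]] := finite_mesh_vertices Th.
pose K : finType := ((I * 'I_2) * 'I_3 + J)%type.
pose cc (c : 'rV[R]_#|K|) (k : K) : R := c 0 (enum_rank k).
pose aff (c : 'rV[R]_#|K|) k (x : pt) := cc c (inl (k, 0)) +
  cc c (inl (k, 1)) * x.1 + cc c (inl (k, 2%:R)) * x.2.
exists #|K|, (fun s c => (forall k j, ae_eq_on (T k) (s.1 j) (aff c (k, j))) /\
  (forall k, ae_eq_on (dual_cell Td (y k)) s.2 (cst (cc c (inr k))))).
split.
- move=> s [[Vs Ps] [_ Qs]].
  have Ps' (kj : I * 'I_2) : exists abd : R * R * R,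
      ae_eq_on (T kj.1) (s.1 kj.2) (fun x => abd.1.1 + abd.1.2 * x.1 + abd.2 * x.2).
    by have [_ [a [b [d ->]]] H] := Ps _ (IT kj.1) kj.2; exists (a, b, d).
  have Qs' k : exists a : R, ae_eq_on (dual_cell Td (y k)) s.2 (cst a).
    by have [_ [a ->] H] := Qs _ (Jy k); exists a.
  have [g1 g1P] := choice Ps'; have [g2 g2P] := choice Qs'.
  pose h (k : K) : R := match k with
    | inl (kj, r) => if r == 0 then (g1 kj).1.1 else if r == 1 then (g1 kj).1.2 else (g1 kj).2
    | inr k => g2 k end.
  exists (\row_i h (enum_val i)).
  have ccE k : cc (\row_i h (enum_val i)) k = h k by rewrite /cc mxE enum_rankK.
  split=> [k j|k]; last by rewrite ccE; exact: g2P.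
  by rewrite /aff; under eq_fun do rewrite !ccE/=; exact: (g1P (k, j)).
- move=> a s t c e [sT sM] [tT tM]; split.
    move=> k j; rewrite comb1E.
    have -> : aff (a *: c + e) (k, j) = comb a (aff c (k, j)) 1 (aff e (k, j)).
      by apply/funext => x; rewrite /aff /cc !mxE; ring.
    exact: ae_eq_on_comb.
  move=> k; rewrite comb2E.
  have -> : cst (cc (a *: c + e) (inr k)) =
      comb a (cst (cc c (inr k))) 1 (cst (cc e (inr k))) :> (pt -> R).
    by apply/funext => x; rewrite /cc !mxE /= mul1r.
  exact: ae_eq_on_comb.
- move=> s _ [sT sM].
  have cc0 k : cc 0 k = 0 by rewrite /cc mxE.
  have OT : Omega `<=` \bigcup_k T k.
    move=> x /subset_closure; rewrite -covT => -[T' /TI[k ->] Tx]; by exists k.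
  have OM : Omega `<=` \bigcup_k dual_cell Td (y k).
    move=> x /subset_closure; rewrite -covM => -[i /yJ[k ->] ix]; by exists k.
  split=> [j|].
    apply: ae_eq_on_cover OT _ => k; apply: ae_mp (sT k j) => x sx Tx.
    by rewrite sx// /aff !cc0 !mul0r !addr0.
  by apply: ae_eq_on_cover OM _ => k; have := sM k; rewrite cc0.
Qed.

Variables (lam mu : R) (f : 'I_2 -> pt -> R).
Hypotheses (lam0 : 0 < lam) (mu0 : 0 < mu) (L2f : forall j, L2 Omega (f j)).

(** The second equation enters with the opposite sign: this turns the indefinite
    saddle point form into a definite one, as the mixed terms cancel on the
    diagonal. *)
Definition saddle_form (s t : X) : R :=
  form_a Omega mu s.1 t.1 + form_b Omega t.1 s.2 -
  (form_b Omega s.1 t.2 - lam^-1 * form_c Omega s.2 t.2).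

Lemma Vh_V0 v : Vh v -> V0 Omega v. Proof. by case. Qed.

Lemma Qh_L2 q : Qh q -> L2 Omega q. Proof. by case=> -[]. Qed.

Lemma null_cst0 : null (cst 0 : pt -> R).
Proof. exact: aeW. Qed.

Lemma saddle_form_linl t : discrete_space t -> linear_on discrete_space (saddle_form ^~ t).
Proof.
move=> [/Vh_V0 Vt /Qh_L2 Qt] a s r [/Vh_V0 Vs /Qh_L2 Qs] [/Vh_V0 Vr /Qh_L2 Qr].
rewrite /saddle_form comb1E comb2E.
rewrite (form_a_combl oO bO mu a 1 Vs Vr Vt) (form_b_comb_q oO a 1 Vt Qs Qr).
rewrite (form_b_comb_v oO bO a 1 Vs Vr Qt) (form_c_comb oO a 1 Qs Qr Qt).
move: (form_a _ _ s.1 _) (form_a _ _ r.1 _) (form_b _ t.1 s.2) (form_b _ t.1 r.2).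
move: (form_b _ s.1 t.2) (form_b _ r.1 t.2) (form_c _ s.2 _) (form_c _ r.2 _).
by move=> *; ring.
Qed.

Lemma saddle_form_linr s : discrete_space s -> linear_on discrete_space (saddle_form s).
Proof.
move=> [/Vh_V0 Vt /Qh_L2 Qt] a t r [/Vh_V0 Vs /Qh_L2 Qs] [/Vh_V0 Vr /Qh_L2 Qr].
rewrite /saddle_form comb1E comb2E.
rewrite (form_aC oO mu Vt (V0_comb oO bO a 1 Vs Vr)) (form_a_combl oO bO mu a 1 Vs Vr Vt).
rewrite -(form_aC oO mu Vt Vs) -(form_aC oO mu Vt Vr).
rewrite (form_b_comb_q oO a 1 Vt Qs Qr) (form_b_comb_v oO bO a 1 Vs Vr Qt).
rewrite !(form_cC Omega s.2) (form_c_comb oO a 1 Qs Qr Qt).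
move: (form_a _ _ _ t.1) (form_a _ _ _ r.1) (form_b _ t.1 s.2) (form_b _ r.1 s.2).
move: (form_b _ s.1 t.2) (form_b _ s.1 r.2) (form_c _ t.2 _) (form_c _ r.2 _).
by move=> *; ring.
Qed.

Lemma saddle_form_nulll s t : discrete_space s -> discrete_space t -> null_pair s ->
  saddle_form s t = 0.
Proof.
move=> [/Vh_V0 Vs /Qh_L2 Qs] [/Vh_V0 Vt /Qh_L2 Qt] [s1 s2]; rewrite /saddle_form.
rewrite (form_a_null oO bO mu Vs Vt s1) (form_b_null_q oO Vt Qs s2).
rewrite (form_b_null_v oO bO Vs Qt s1) (form_c_null oO Qs Qt s2).
by rewrite mulr0 !subr0 addr0.
Qed.

Lemma saddle_form_nullr s t : discrete_space s -> discrete_space t -> null_pair t ->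
  saddle_form s t = 0.
Proof.
move=> [/Vh_V0 Vs /Qh_L2 Qs] [/Vh_V0 Vt /Qh_L2 Qt] [t1 t2]; rewrite /saddle_form.
rewrite (form_aC oO mu Vs Vt) (form_a_null oO bO mu Vt Vs t1) (form_b_null_q oO Vs Qt t2).
rewrite (form_b_null_v oO bO Vt Qs t1) form_cC (form_c_null oO Qt Qs t2).
by rewrite mulr0 !subr0 addr0.
Qed.

Lemma saddle_form_definite t : discrete_space t -> saddle_form t t = 0 -> null_pair t.
Proof.
have cancel_b (a b c : R) : a + b - (b - c) = a + c by ring.
move=> [/Vh_V0 Vt /Qh_L2 Qt]; rewrite /saddle_form cancel_b => H.
exact: (energy_null oO bO lam0 mu0 Vt Qt H).
Qed.

(** Testing with a zero pressure, then with a zero displacement, separates the two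
    equations. *)
Lemma discrete_solutionP s : discrete_space s ->
  discrete_solution Omega Th Td lam mu f s.1 s.2 <->
  forall t, discrete_space t -> saddle_form s t = load Omega f t.1.
Proof.
move=> [/[dup] Vhs /Vh_V0 Vs /[dup] Qhs /Qh_L2 Qs]; split.
  move=> [eqv eqq] t [Vt Qt]; rewrite /saddle_form eqq// subr0; exact: eqv.
move=> H; split=> [v Vv|q Qq].
  rewrite -(H (v, cst 0)); last by split => //; exact: Qh0.
  rewrite /saddle_form /= (form_b_null_q oO Vs (Qh_L2 Qh0) null_cst0).
  rewrite form_cC (form_c_null oO (Qh_L2 Qh0) Qs null_cst0).
  by rewrite mulr0 !subr0.
have Vh0' := Vh_V0 Vh0.
have := H (fun=> cst 0, q) (conj Vh0 Qq); rewrite /saddle_form /=.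
rewrite (form_aC oO mu Vs Vh0') (form_a_null oO bO mu Vh0' Vs (fun=> null_cst0)).
rewrite (form_b_null_v oO bO Vh0' Qs (fun=> null_cst0)) (load_null oO L2f Vh0' (fun=> null_cst0)).
by rewrite addr0 sub0r => /eqP; rewrite oppr_eq0 => /eqP.
Qed.

Lemma discrete_problem_well_posed :
  \bigcup_(T in third_mesh Th Td) T = closure Omega ->
  \bigcup_(i in mesh_vertices Th) dual_cell Td i = closure Omega ->
  exists s, [/\ discrete_space s, discrete_solution Omega Th Td lam mu f s.1 s.2 &
    forall t, discrete_space t -> discrete_solution Omega Th Td lam mu f t.1 t.2 ->
      (forall j, ae_eq_on Omega (t.1 j) (s.1 j)) /\ ae_eq_on Omega t.2 s.2].
Proof.
move=> covT covM.
have [n [rel [rel_ex rel_lin rel_null]]] := discrete_coordinates covT covM.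
have loadlin : linear_on discrete_space (fun s : X => load Omega f s.1).
  move=> a s t [/Vh_V0 Vs _] [/Vh_V0 Vt _].
  by rewrite comb1E (load_comb oO bO a 1 L2f Vs Vt) mul1r.
have [s Ss sP] := galerkin_solvable subspace_discrete rel_ex rel_lin rel_null
  saddle_form_linl saddle_form_linr loadlin saddle_form_nulll saddle_form_nullr
  (fun t St => load_null oO L2f (Vh_V0 St.1) \o (@proj1 _ _))
  (fun t St H => saddle_form_definite St (H t St)).
exists s; split => //; first exact/(discrete_solutionP Ss).
move=> t St /(discrete_solutionP St) tP.
have Sd : discrete_space (-1 *: s + t) by case: subspace_discrete => _; exact.
have [] : null_pair (-1 *: s + t); last first.
  rewrite comb1E comb2E => d1 d2.
  by split=> [j|]; apply: ae_eq_of_difference; [exact: d1|exact: d2].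
apply: saddle_form_definite => //.
by rewrite (saddle_form_linl Sd (-1) Ss St) (sP _ Sd) (tP _ Sd) mulN1r addNr.
Qed.

End DiscreteProblem.

Theorem theorem1 (R : realType) (Omega : set (R * R))
    (hOmega : polygonal_domain Omega) (hLip : lipschitz_boundary Omega)
    (lam mu : R) (hlam : 0 < lam) (hmu : 0 < mu)
    (f : 'I_2 -> R * R -> R) (hf : forall j, L2 Omega (f j))
    (Th : primal_mesh R) (hTh : is_primal_mesh Omega Th)
    (Td : dual_mesh R) (hTd : is_dual_mesh Omega Th Td)
    (hthird : \bigcup_(T in third_mesh Th Td) T = closure Omega) :
  exists (u : 'I_2 -> R * R -> R) (p : R * R -> R),
    [/\ Vh Omega Th Td u, Qh Omega Th Td p,
        discrete_solution Omega Th Td lam mu f u p &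
        forall (u' : 'I_2 -> R * R -> R) (p' : R * R -> R),
          Vh Omega Th Td u' -> Qh Omega Th Td p' ->
          discrete_solution Omega Th Td lam mu f u' p' ->
          (forall j, ae_eq_on Omega (u' j) (u j)) /\ ae_eq_on Omega p' p].
Proof.
have [oO _ _ bO _] := hOmega; have [_ covM] := hTd.
have [[u p] [[/= Vu Qp] up_sol up_unique]] :=
  discrete_problem_well_posed oO bO hlam hmu hf hthird covM.
exists u, p; split => // u' p' Vu' Qp' sol'.
by have [] := up_unique (u', p') (conj Vu' Qp') sol'.
Qed.
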